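(* For every positive integer $n$, $$N_{(1,1)}^{4,8}(n)=N_{(1,1)}^{8,4}(n)=8\sigma_5(n)-512\sigma_5(\tfrac n4)+16b_{32,1}(n)=r_{12}(n),$$ $$N_{(1,2)}^{4,8}(n)=N_{(2,1)}^{8,4}(n)=\tfrac12\sigma_5(n)-\tfrac12\sigma_5(\tfrac n2)+8\sigma_5(\tfrac n4)-512\sigma_5(\tfrac n8)+\tfrac{15}2b_{32,1}(n)+24b_{32,2}(n)+128b_{32,3}(n),$$ $$N_{(1,2)}^{8,4}(n)=N_{(2,1)}^{4,8}(n)=2\sigma_5(n)-2\sigma_5(\tfrac n2)+8\sigma_5(\tfrac n4)-512\sigma_5(\tfrac n8)+14b_{32,1}(n)-16b_{32,1}(\tfrac n2)+72b_{32,2}(n)+256b_{32,3}(n),$$ $$\begin{aligned}N_{(1,4)}^{4,8}(n)=N_{(4,1)}^{8,4}(n)={}&\tfrac1{32}\sigma_5(n)+\tfrac{15}{32}\sigma_5(\tfrac n2)-\tfrac{65}2\sigma_5(\tfrac n4)+40\sigma_5(\tfrac n8)-512\sigma_5(\tfrac n{16})+\tfrac{255}{32}b_{32,1}(n)-32b_{32,1}(\tfrac n4)\\&+\tfrac{45}2b_{32,2}(n)+120b_{32,3}(n)+56b_{32,4}(n)+128b_{32,5}(n)+384b_{32,6}(n)+512b_{32,7}(n),\end{aligned}$$ $$\begin{aligned}N_{(1,4)}^{8,4}(n)=N_{(4,1)}^{4,8}(n)={}&\tfrac12\sigma_5(n)-\tfrac52\sigma_5(\tfrac n2)+130\sigma_5(\tfrac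 n4)-120\sigma_5(\tfrac n8)-512\sigma_5(\tfrac n{16})+\tfrac{31}2b_{32,1}(n)-28b_{32,1}(\tfrac n2)+128b_{32,1}(\tfrac n4)\\&+126b_{32,2}(n)-144b_{32,2}(\tfrac n2)+512b_{32,3}(n)-512b_{32,3}(\tfrac n2)+584b_{32,4}(n)+1792b_{32,5}(n)\\&+2304b_{32,6}(n)+1024b_{32,7}(n).\end{aligned}$$
   Context: $\sigma_5(n)=\sum_{0<d\mid n}d^5$ for positive integers $n$, and $\sigma_5(x)=0$ if $x$ is not a positive integer. For positive integers $a,b$: $N_{(a,b)}^{4,8}(n)$ is the number of $(x_1,\dots,x_{12})\in\mathbb{Z}^{12}$ with $n=a\sum_{i=1}^4x_i^2+b\sum_{i=5}^{12}x_i^2$; $N_{(a,b)}^{8,4}(n)$ is the number of $(x_1,\dots,x_{12})\in\mathbb{Z}^{12}$ with $n=a\sum_{i=1}^{8}x_i^2+b\sum_{i=9}^{12}x_i^2$; $r_{12}(n)$ is the number of $(x_1,\dots,x_{12})\in\mathbb{Z}^{12}$ with $n=\sum_{i=1}^{12}x_i^2$. With $q=e^{2\pi iz}$, $\eta(z)=q^{1/24}\prod_{m\ge1}(1-q^m)$ and $\eta_d=\eta(dz)$, $b_{32,i}(n)$ is the coefficient of $q^n$ in $B_{32,i}$ (and $b_{32,i}(x)=0$ if $x$ is not a positive integer), where $B_{32,1}=\eta_2^{12}$, $B_{32,2}=\eta_4^{12}$, $B_{32,3}=\eta_2^4\eta_8^8$, $B_{32,4}=\eta_8^{12}$, $B_{32,5}=\eta_4^2\eta_8^6\eta_{16}^4$,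 $B_{32,6}=\eta_4^4\eta_{16}^8$, $B_{32,7}=\eta_4^6\eta_8^{-6}\eta_{16}^{12}$. *)

(* Defs.v *)
From HB Require Import structures.
From mathcomp Require Import all_boot all_order all_algebra finmap.
From mathcomp Require Import classical_sets cardinality.

Set Implicit Arguments.
Unset Strict Implicit.
Unset Printing Implicit Defensive.

Import Order.TTheory GRing.Theory Num.Theory.
Local Open Scope ring_scope.

Definition sumsq (k : nat) (x : 'rV[int]_k) : int := \sum_i x 0 i ^+ 2.

(* Junk convention of fset_set: it is empty on infinite sets.  The sets below
   are finite as soon as 0 < a and 0 < b. *)
Definition repN (k l a b n : nat) : nat :=
  #|` fset_set [set x : 'rV[int]_(k + l) |
       (n%:Z = a%:Z * sumsq (lsubmx x) + b%:Z * sumsq (rsubmx x))%R]%classic |%fset.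

Definition repr12 (n : nat) : nat :=
  #|` fset_set [set x : 'rV[int]_12 | n%:Z = sumsq x :> int]%classic |%fset.

(* Extends an arithmetic function on the positive integers by 0 to rational
   arguments, so that f (n / 2) etc. make sense. *)
Definition ext0 (f : nat -> rat) (x : rat) : rat :=
  if (x \is a Num.nat) && (0 < x) then f (Num.truncn x) else 0.

Definition sigma5 : rat -> rat :=
  ext0 (fun n => (\sum_(d <- divisors n) d ^ 5)%N%:R).

(* Formal power series over rat, as coefficient sequences. *)
Definition fps_mul (f g : nat -> rat) (n : nat) : rat :=
  \sum_(i < n.+1) f i * g (n - i)%N.

Definition fps_one (n : nat) : rat := (n == 0%N)%:R.

Definition fps_exp (f : nat -> rat) (k : nat) : nat -> rat :=
  iter k (fps_mul f) fps_one.

(* With c = f 0 <> 0, this is 1 / f = c^-1 * \sum_k (1 - f / c)^k.  As 1 - f / c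
   has no constant term, only k <= n contributes to the n-th coefficient. *)
Definition fps_inv (f : nat -> rat) (n : nat) : rat :=
  (f 0%N)^-1 *
  \sum_(k < n.+1) fps_exp (fun j => fps_one j - f j / f 0%N) k n.

(* QSeries e f stands for q^e * \sum_(k >= 0) f k q^k; the exponent is rational
   because of the factor q^(1/24) of the eta function. *)
Record qseries := QSeries { qexpo : rat; qcoefs : nat -> rat }.

Definition qmul (A B : qseries) : qseries :=
  QSeries (qexpo A + qexpo B) (fps_mul (qcoefs A) (qcoefs B)).

Definition qone : qseries := QSeries 0 fps_one.

(* Meaningful when qcoefs A 0 <> 0, as is the case for eta. *)
Definition qinv (A : qseries) : qseries :=
  QSeries (- qexpo A) (fps_inv (qcoefs A)).

Definition qpow (A : qseries) (k : int) : qseries :=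
  match k with
  | Posz m => iter m (qmul A) qone
  | Negz m => iter m.+1 (qmul (qinv A)) qone
  end.

(* The substitution q -> q^d, that is z -> d z, for d > 0. *)
Definition qdilate (d : nat) (A : qseries) : qseries :=
  QSeries (d%:R * qexpo A)
          (fun n => if (d %| n)%N then qcoefs A (n %/ d)%N else 0).

Definition qcoef (A : qseries) (x : rat) : rat :=
  if x - qexpo A \is a Num.nat then qcoefs A (Num.truncn (x - qexpo A)) else 0.

(* q^(1/24) * \prod_(m >= 1) (1 - q^m): the factors with m > n do not affect
   the coefficient of q^n of the infinite product. *)
Definition eta : qseries :=
  QSeries (1 / 24%:R) (fun n => (\prod_(1 <= m < n.+1) (1 - 'X^m) : {poly rat})`_n).

(* \prod_d eta(d z)^(r_d) over the pairs (d, r_d) of the list. *)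
Definition eta_quotient (s : seq (nat * int)) : qseries :=
  foldr (fun p => qmul (qpow (qdilate p.1 eta) p.2)) qone s.

(* Only the indices 1, ..., 7 are meaningful. *)
Definition B32 (i : nat) : qseries :=
  match i with
  | 1 => eta_quotient [:: (2%N, 12%Z)]
  | 2 => eta_quotient [:: (4%N, 12%Z)]
  | 3 => eta_quotient [:: (2%N, 4%Z); (8%N, 8%Z)]
  | 4 => eta_quotient [:: (8%N, 12%Z)]
  | 5 => eta_quotient [:: (4%N, 2%Z); (8%N, 6%Z); (16%N, 4%Z)]
  | 6 => eta_quotient [:: (4%N, 4%Z); (16%N, 8%Z)]
  | 7 => eta_quotient [:: (4%N, 6%Z); (8%N, (- 6)%Z); (16%N, 12%Z)]
  | _ => QSeries 0 (fun=> 0)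
  end.

Definition b32 (i : nat) : rat -> rat := ext0 (fun n => qcoef (B32 i) n%:R).

(* Main.v *)
(* With theta_2, theta_3, theta_4 the theta constants, put th3 = theta_3(q^4) and
   th2 = theta_2(q^4).  As theta_3(q) = th3 + th2, theta_3(q^2)^2 = th3^2 + th2^2 and
   theta_3(q^4) = th3, all five left-hand sides are forms of degree 12 in th3, th2,
   and one shows that all series on the right are such forms too.

   Eta quotients.  phi(-q) eta(2z) = eta(z)^2 because both sides solve the same
   first order linear differential equation for D = q d/dq; everything else
   follows from the doubling formulas P^2 = x^2 + y^2 and S^2 = 2 x y, where
   P, S = th3, th2 and x, y are their images under q -> q^2.

   Derivatives.  The doubling formulas turn the Wronskian W = P DS - S DP into a
   solution of P S W = 2 (x^2 - y^2) W(q^2); this equation has only one solution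
   with given first coefficient, so W = P S (P^4 - S^4).

   Eisenstein series.  The logarithmic derivative in y of
   \sum_n (-1)^n q^(n^2) y^n is a Lambert series; expanding it at y = 1 expresses
   \sum_(d odd) j^k q^(j d), k = 1, 3, 5, through D-derivatives of phi(-q).  For k = 3
   and for the series of sigma_5 itself, functional equations f(q) = m f(q^2) + known
   identify the result as a form in P, S.  The remaining identities between forms
   are polynomial identities. *)

From HB Require Import structures.
From mathcomp Require Import all_boot all_order all_algebra finmap.
From mathcomp Require Import boolp classical_sets cardinality.
From mathcomp Require Import zify ring lra.
Require Import Defs.

Import Order.TTheory GRing.Theory Num.Theory.
Local Open Scope ring_scope.

(** * Formal power series over the rationals *)

(** A record keeps the convolution product apart from pointwise operations on functions; its
    equality is made decidable classically. *)
Record fps := Fps { fcoef : nat -> rat }.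

HB.instance Definition _ := gen_eqMixin fps.
HB.instance Definition _ := gen_choiceMixin fps.

Notation "f @_ n" := (fcoef f n) (at level 8, n at level 2, format "f @_ n").

Lemma fpsP (f g : fps) : (forall n, f@_n = g@_n) <-> f = g.
Proof.
split=> [fg|-> //].
by case: f g fg => f [g] /= fg; congr Fps; apply: funext.
Qed.

Definition fzero := Fps (fun=> 0).
Definition fopp f := Fps (fun n => - f@_n).
Definition fadd f g := Fps (fun n => f@_n + g@_n).

Lemma faddA : associative fadd.
Proof. by move=> f g h; apply/fpsP=> n /=; rewrite addrA. Qed.
Lemma faddC : commutative fadd.
Proof. by move=> f g; apply/fpsP=> n /=; rewrite addrC. Qed.
Lemma fadd0 : left_id fzero fadd.
Proof. by move=> f; apply/fpsP=> n /=; rewrite add0r. Qed.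
Lemma faddN : left_inverse fzero fopp fadd.
Proof. by move=> f; apply/fpsP=> n /=; rewrite addNr. Qed.

HB.instance Definition _ := GRing.isZmodule.Build fps faddA faddC fadd0 faddN.

Definition fone := Fps fps_one.
Definition fmul f g := Fps (fps_mul (fcoef f) (fcoef g)).

(** Product coefficients below N involve only coefficients below N, so truncation transports
    associativity and commutativity from [{poly rat}]. *)
Definition ftrunc N (f : fps) : {poly rat} := \poly_(i < N) f@_i.

Lemma coef_ftrunc N f n : (n < N)%N -> (ftrunc N f)`_n = f@_n.
Proof. by move=> nN; rewrite coef_poly nN. Qed.

Lemma fmul_ftrunc N f g n :
  (n < N)%N -> (fmul f g)@_n = (ftrunc N f * ftrunc N g)`_n.
Proof.
move=> nN; rewrite coefM; apply: eq_bigr => i _.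
by rewrite !coef_ftrunc //; have := ltn_ord i; lia.
Qed.

Lemma fmulA : associative fmul.
Proof.
move=> f g h; apply/fpsP=> n /=; rewrite /fps_mul.
transitivity ((ftrunc n.+1 f * (ftrunc n.+1 g * ftrunc n.+1 h))`_n).
  rewrite coefM; apply: eq_bigr => i _; have := ltn_ord i => ltin.
  by rewrite coef_ftrunc // -(fmul_ftrunc n.+1) //; lia.
rewrite mulrA coefM; apply: eq_bigr => i _; have := ltn_ord i => ltin.
by rewrite (coef_ftrunc _ h) -?(fmul_ftrunc n.+1 f g) //; lia.
Qed.

Lemma fmulC : commutative fmul.
Proof. by move=> f g; apply/fpsP=> n; rewrite !(fmul_ftrunc n.+1) // mulrC. Qed.

Lemma fmul1 : left_id fone fmul.
Proof.
move=> f; apply/fpsP=> n /=.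
rewrite /fps_mul big_ord_recl /= mul1r subn0 big1 ?addr0 // => i _.
by rewrite /fps_one /= mul0r.
Qed.

Lemma fmulDl : left_distributive fmul fadd.
Proof.
move=> f g h; apply/fpsP=> n /=; rewrite /fps_mul -big_split.
by apply: eq_bigr => i _; rewrite mulrDl.
Qed.

Lemma fone_neq0 : fone != 0 :> fps.
Proof. by apply/eqP => /fpsP/(_ 0%N)/eqP. Qed.

HB.instance Definition _ :=
  GRing.Zmodule_isComNzRing.Build fps fmulA fmulC fmul1 fmulDl fone_neq0.

Implicit Types f g h : fps.

Lemma fcoefD f g n : (f + g)@_n = f@_n + g@_n. Proof. by []. Qed.
Lemma fcoefN f n : (- f)@_n = - f@_n. Proof. by []. Qed.
Lemma fcoefB f g n : (f - g)@_n = f@_n - g@_n. Proof. by []. Qed.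
Lemma fcoef0 n : (0 : fps)@_n = 0. Proof. by []. Qed.
Lemma fcoef1 n : (1 : fps)@_n = (n == 0)%N%:R. Proof. by []. Qed.
Lemma fcoefM f g n : (f * g)@_n = \sum_(i < n.+1) f@_i * g@_(n - i).
Proof. by []. Qed.

Lemma fcoefM0 f g : (f * g)@_0 = f@_0 * g@_0.
Proof. by rewrite fcoefM big_ord_recl big_ord0 addr0. Qed.

Lemma fcoef_sum I (r : seq I) (Q : pred I) (F : I -> fps) n :
  (\sum_(i <- r | Q i) F i)@_n = \sum_(i <- r | Q i) (F i)@_n.
Proof. exact: (big_morph (fun f => f@_n)). Qed.

Lemma fcoefMn f m n : (f *+ m)@_n = f@_n *+ m.
Proof. by elim: m => // m IH; rewrite !mulrS fcoefD IH. Qed.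

Lemma fcoef_natM f m n : (m%:R * f)@_n = m%:R * f@_n.
Proof. by rewrite !mulr_natl fcoefMn. Qed.

Lemma fcoef_exp0 f m : (f ^+ m)@_0 = f@_0 ^+ m.
Proof. by elim: m => // m IH; rewrite !exprS fcoefM0 IH. Qed.

Lemma fcoefM_le f f' g g' n : (forall i, (i <= n)%N -> f@_i = f'@_i) ->
  (forall i, (i <= n)%N -> g@_i = g'@_i) ->
  forall i, (i <= n)%N -> (f * g)@_i = (f' * g')@_i.
Proof.
move=> ff gg i lein; rewrite !fcoefM; apply: eq_bigr => j _.
by rewrite ff ?gg //; have := ltn_ord j; lia.
Qed.

Lemma fps_ord f : f != 0 ->
  exists m, f@_m != 0 /\ forall i, (i < m)%N -> f@_i = 0.
Proof.
move=> f0; have ex : exists n, f@_n != 0.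
  apply: contrapT => nex; move/eqP: f0; apply; apply/fpsP => n.
  by apply/eqP; apply: contrapT => /negP fn; apply: nex; exists n.
exists (ex_minn ex); case: ex_minnP => m fm min; split=> // i im.
by apply/eqP; apply: contraLR im => /min; rewrite -leqNgt.
Qed.

(** If m and l are the orders of two nonzero series, the coefficient of index m + l in their product
    is the single term [f@_m * g@_l]. *)
Lemma fmul_eq0 f g : f * g = 0 -> f != 0 -> g = 0.
Proof.
move=> fg0 /fps_ord[m [fm fmin]]; apply/eqP/negP => /negP /fps_ord[l [gl gmin]].
have /fpsP/(_ (m + l)%N) := fg0; rewrite fcoefM.
have ltm : (m < (m + l).+1)%N by lia.
rewrite (bigD1 (Ordinal ltm)) //= addKn big1.
  by rewrite addr0 => /eqP; rewrite mulf_eq0 (negPf fm) (negPf gl).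
move=> i /eqP ne; have nei : nat_of_ord i <> m by move=> e; apply/ne/val_inj.
case: (ltnP i m) => im; first by rewrite fmin // mul0r.
by rewrite gmin ?mulr0 //; have := ltn_ord i; lia.
Qed.

Lemma fmulI f g h : f != 0 -> f * g = f * h -> g = h.
Proof.
move=> f0 e; apply/eqP; rewrite -subr_eq0; apply/eqP.
by apply: fmul_eq0 f0; rewrite mulrBr e subrr.
Qed.

Lemma fps_neq0 f n : f@_n != 0 -> f != 0.
Proof. by apply: contraNneq => ->. Qed.

Lemma fnat_neq0 n : (0 < n)%N -> n%:R != 0 :> fps.
Proof.
by move=> n0; apply: (fps_neq0 _ 0); rewrite fcoefMn fcoef1 pnatr_eq0 -lt0n.
Qed.

Definition fX := Fps (fun n => (n == 1)%N%:R).

Lemma fcoefMX f n : (fX * f)@_n = if n is m.+1 then f@_m else 0.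
Proof.
rewrite fcoefM; case: n => [|n]; first by rewrite big_ord1 /= mul0r.
rewrite 2!big_ord_recl /= mul0r mul1r add0r subSS subn0 big1 ?addr0 // => i _.
by rewrite mul0r.
Qed.

Lemma fcoefMXn f m n :
  (fX ^+ m * f)@_n = if (n < m)%N then 0 else f@_(n - m).
Proof.
elim: m n => [|m IH] n; first by rewrite mul1r subn0.
by rewrite exprS -mulrA fcoefMX; case: n => // n; rewrite IH ltnS subSS.
Qed.

Lemma fcoefXn m n : (fX ^+ m)@_n = (n == m)%:R.
Proof.
rewrite -[fX ^+ m]mulr1 fcoefMXn fcoef1.
by case: ltngtP => [//|lt|->]; rewrite ?subnn // subn_eq0 leqNgt lt.
Qed.

(** * The derivation D = q d/dq and the substitution q -> q^d *)

Definition fD f := Fps (fun n => n%:R * f@_n).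

Lemma fDD f g : fD (f + g) = fD f + fD g.
Proof. by apply/fpsP => n; rewrite /= mulrDr. Qed.
Lemma fDN f : fD (- f) = - fD f.
Proof. by apply/fpsP => n; rewrite /= mulrN. Qed.
Lemma fDB f g : fD (f - g) = fD f - fD g.
Proof. by rewrite fDD fDN. Qed.

Lemma fDM f g : fD (f * g) = fD f * g + f * fD g.
Proof.
apply/fpsP => n; rewrite fcoefD !fcoefM /= /fps_mul mulr_sumr -big_split /=.
apply: eq_bigr => i _; have lein : (i <= n)%N by have := ltn_ord i.
by rewrite -{1}(subnKC lein) natrD; ring.
Qed.

Lemma fD1 : fD 1 = 0.
Proof.
by apply/fpsP => -[|n]; rewrite /= ?mul0r // /fps_one /= mulr0.
Qed.

Lemma fD_nat n : fD n%:R = 0.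
Proof.
by elim: n => [|n IH]; rewrite ?mulrS ?fDD ?fD1 ?IH ?addr0 //;
   apply/fpsP => m; rewrite /= mulr0.
Qed.

Lemma fDX f n : fD (f ^+ n) = n%:R * f ^+ n.-1 * fD f.
Proof.
elim: n => [|n IH]; first by rewrite !mul0r fD1.
rewrite exprS fDM IH /=; case: n {IH} => [|n];
  first by rewrite !mul1r mul0r mul0r mulr0 addr0 mulr1.
by rewrite /= -[n.+2]addn1 natrD exprS; ring.
Qed.

(** The substitution q -> q^d, in the same coefficient form as [qdilate]. *)
Definition dil d f :=
  Fps (fun n => if (d %| n)%N then f@_(n %/ d) else 0).

Lemma dilD d f g : dil d (f + g) = dil d f + dil d g.
Proof. by apply/fpsP => n /=; case: ifP => _ //; rewrite addr0. Qed.
Lemma dilN d f : dil d (- f) = - dil d f.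
Proof. by apply/fpsP => n /=; case: ifP => _ //; rewrite oppr0. Qed.
Lemma dilB d f g : dil d (f - g) = dil d f - dil d g.
Proof. by rewrite dilD dilN. Qed.
Lemma dil0 d : dil d 0 = 0.
Proof. by apply/fpsP => n /=; case: ifP. Qed.

Lemma fcoef_dil0 d f : (dil d f)@_0 = f@_0.
Proof. by rewrite /= dvdn0 div0n. Qed.

Lemma sum_ord_mul (d n : nat) (F : nat -> rat) : (0 < d)%N ->
  \sum_(i < (d * n).+1 | (d %| i)%N) F i = \sum_(i < n.+1) F (d * i)%N.
Proof.
move=> d0; have lt (i : 'I_n.+1) : (d * i < (d * n).+1)%N.
  by rewrite ltnS leq_mul2l -ltnS ltn_ord orbT.
rewrite (reindex_onto (fun i : 'I_n.+1 => Ordinal (lt i))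
                      (fun i => inord (i %/ d))) /=.
  apply: eq_bigl => i; rewrite dvdn_mulr //=; apply/eqP/val_inj.
  by rewrite /= mulKn // inordK.
move=> i di; apply/val_inj; rewrite /= inordK; first by rewrite mulnC divnK.
by have := ltn_ord i; rewrite !ltnS leq_divLR // [(n * d)%N]mulnC.
Qed.

Lemma dilM d f g : (0 < d)%N -> dil d (f * g) = dil d f * dil d g.
Proof.
move=> d0; apply/fpsP => n; rewrite [RHS]fcoefM /=; case: ifPn => dn; last first.
  rewrite big1 // => i _; case: ifPn => di; rewrite ?mul0r //.
  case: ifPn => di'; rewrite ?mulr0 //; case/negP: dn.
  by rewrite -(subnKC (_ : i <= n)%N) ?dvdn_add //; have := ltn_ord i.
rewrite /fps_mul; move: dn => /dvdnP[m ->]; rewrite mulnK // mulnC.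
rewrite [RHS](bigID (fun i : 'I_ _ => d %| i)%N) /= [X in _ + X]big1 ?addr0; last first.
  by move=> i /negPf->; rewrite mul0r.
rewrite (sum_ord_mul d m (fun i => (if (d %| i)%N then f@_(i %/ d) else 0) *
  (if (d %| d * m - i)%N then g@_((d * m - i) %/ d) else 0))) //.
by apply: eq_bigr => i _; rewrite -mulnBr !dvdn_mulr // !mulKn.
Qed.

Lemma dil1 d : (0 < d)%N -> dil d 1 = 1.
Proof.
move=> d0; apply/fpsP => n; rewrite fcoef1 /=; case: ifPn => [/dvdnP[m ->]|dn].
  by rewrite mulnK // /fps_one muln_eq0 (gtn_eqF d0) orbF.
by case: eqP dn => // ->; rewrite dvdn0.
Qed.

Lemma dil_nat d n : (0 < d)%N -> dil d n%:R = n%:R.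
Proof.
move=> d0; elim: n => [|n IH]; first exact: dil0.
by rewrite mulrS dilD IH dil1.
Qed.

Lemma dilX d f n : (0 < d)%N -> dil d (f ^+ n) = dil d f ^+ n.
Proof.
move=> d0; elim: n => [|n IH]; first exact: dil1.
by rewrite !exprS dilM ?IH.
Qed.

Lemma dil_dil a b f : (0 < a)%N -> dil a (dil b f) = dil (a * b) f.
Proof.
move=> a0; apply/fpsP => n /=; case: ifPn => an.
  by rewrite -divnMA dvdn_divRL // [(b * a)%N]mulnC.
by case: ifPn => // /(dvdn_trans (dvdn_mulr _ (dvdnn a))); rewrite (negPf an).
Qed.

Lemma dil_fX d : (0 < d)%N -> dil d fX = fX ^+ d.
Proof.
move=> d0; apply/fpsP => n; rewrite fcoefXn /=; case: ifPn => dn.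
  by rewrite eq_sym eqn_div // mul1n eq_sym.
by case: eqP dn => // ->; rewrite dvdnn.
Qed.

Lemma fD_dil d f : (0 < d)%N -> fD (dil d f) = d%:R * dil d (fD f).
Proof.
move=> d0; apply/fpsP => n; rewrite fcoef_natM /=; case: ifP => [dn|];
  last by rewrite !mulr0.
by rewrite mulrA -natrM mulnC divnK.
Qed.

(** The coefficient of index n is 0 or m times the one of index n / 2, which is smaller for n > 0.
    The constant term has to be prescribed: for m = 1 every constant is a solution. *)
Lemma dil_uniq (m : nat) f : f@_0 = 0 -> f = m%:R * dil 2 f -> f = 0.
Proof.
move=> f0 e; apply/fpsP => n; elim/ltn_ind: n => -[//|n] IH.
rewrite e fcoef_natM /=; case: ifP => _; last by rewrite mulr0.
by rewrite IH ?mulr0 // ltn_Pdiv.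
Qed.

(** As h starts at q, the coefficient of q^(n+1) on the left is [h@_1 * f@_n] plus earlier terms,
    while the right-hand side only involves f up to (n+1)/2, which is below n for n >= 2. The cases
    n = 0, 1 are initial data. *)
Lemma dil_uniq2 (h k f : fps) : h@_0 = 0 -> h@_1 != 0 -> f@_0 = 0 -> f@_1 = 0 ->
  h * f = k * dil 2 f -> f = 0.
Proof.
move=> h0 h1 f0 f1 e; apply/fpsP => n; elim/ltn_ind: n => -[//|[//|n]] IH.
have /fpsP/(_ n.+3) := e; rewrite !fcoefM.
rewrite [in RHS]big1; last first.
  move=> i _ /=; case: ifP => _; last by rewrite mulr0.
  rewrite IH ?mulr0 // (leq_ltn_trans (leq_div2r 2 (leq_subr i n.+3))) //.
  by rewrite ltn_divLR // muln2; lia.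
rewrite 2!big_ord_recl h0 mul0r add0r big1 => [|i _].
  by rewrite addr0 => /eqP; rewrite mulf_eq0 (negPf h1) => /eqP.
by rewrite IH ?mulr0 //= !/bump /=; have := ltn_ord i; lia.
Qed.

(** Since g has no constant term, the equation expresses (n+1) times the coefficient of index n+1
    through the coefficients up to n. *)
Lemma ode_uniq g f h : g@_0 = 0 -> fD f = g * f -> fD h = g * h ->
  f@_0 = h@_0 -> f = h.
Proof.
move=> g0 ef eh e0; apply/fpsP => n; elim/ltn_ind: n => -[//|n] IH.
have n0 : n.+1%:R != 0 :> rat by rewrite pnatr_eq0.
apply: (mulfI n0); have /fpsP/(_ n.+1) /= -> := ef.
have /fpsP/(_ n.+1) /= -> := eh; rewrite /fps_mul !big_ord_recl g0 !mul0r.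
congr (_ + (_ + _)); first by rewrite IH //= /bump /=; lia.
by apply: eq_bigr => i _; rewrite IH //= !/bump /=; lia.
Qed.

(** * Generating functions of finite-to-one maps *)

(** Replaces sums of finite support over infinite types such as [int]: the covering list does not
    matter. *)
Lemma cover_sum (T : eqType) (s t : seq T) (F : T -> rat) :
    uniq s -> uniq t -> (forall x, F x != 0 -> x \in s) ->
    (forall x, F x != 0 -> x \in t) ->
  \sum_(x <- s) F x = \sum_(x <- t) F x.
Proof.
move=> us ut Fs Ft.
have nz r : \sum_(x <- r) F x = \sum_(x <- [seq x <- r | F x != 0]) F x.
  rewrite big_filter (bigID (fun x => F x == 0)) /= big1 ?add0r //.
  by move=> x /eqP.
rewrite (nz s) (nz t); apply: perm_big; apply: uniq_perm; rewrite ?filter_uniq //.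
by move=> x; rewrite !mem_filter; case: eqP => //= /eqP F0; rewrite Fs ?Ft.
Qed.

(* f is the formal sum of c x * q^(e x) over all x : T, for e with finite fibers. *)
Definition gf (T : eqType) (e : T -> nat) (c : T -> rat) f :=
  forall n, exists s, [/\ uniq s, forall x, e x = n -> x \in s
    & f@_n = \sum_(x <- s | e x == n) c x].

Section GeneratingFunctions.
Variables (T T' : eqType).
Implicit Types (e : T -> nat) (c : T -> rat).

Lemma gf_coef {e c f} n t : gf T e c f -> uniq t ->
    (forall x, e x = n -> c x != 0 -> x \in t) ->
  f@_n = \sum_(x <- t | e x == n) c x.
Proof.
move=> /(_ n)[s [us es ->]] ut et; rewrite big_mkcond [RHS]big_mkcond.
apply: cover_sum => // x; case: (e x =P n) => [ex|]; rewrite ?eqxx // => cx.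
  exact: es.
exact: et.
Qed.

(** Products need one list that serves all exponents up to N at once. *)
Lemma gf_box e c f N : gf T e c f ->
  exists s, uniq s /\ forall x, (e x <= N)%N -> x \in s.
Proof.
move=> gff; have /choice[s sP] : forall n, exists s : seq T, forall x, e x = n -> x \in s.
  by move=> n; have [s [_ es _]] := gff n; exists s.
exists (undup (flatten [seq s i | i <- iota 0 N.+1])); split; first exact: undup_uniq.
move=> x ex; rewrite mem_undup; apply/flattenP; exists (s (e x)); last exact: sP.
by apply: map_f; rewrite mem_iota.
Qed.

(** The way theta identities are proved below: both sides are shown to count the same weighted
    set. *)
Lemma gf_uniq e c f g : gf T e c f -> gf T e c g -> f = g.
Proof.
move=> gff gfg; apply/fpsP => n; have [s [us es ->]] := gff n.
by rewrite (gf_coef n s gfg) // => x /es.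
Qed.

Lemma gf_eq e e' c c' f : e =1 e' -> c =1 c' -> gf T e c f -> gf T e' c' f.
Proof. by move=> /funext <- /funext <-. Qed.

Lemma gf_add e c c' f g :
  gf T e c f -> gf T e c' g -> gf T e (fun x => c x + c' x) (f + g).
Proof.
move=> gff gfg n; have [s [us es fn]] := gff n; exists s; split=> //.
by rewrite big_split -fn /= (gf_coef n s gfg) // => x /es.
Qed.

Lemma gf_scale e c m f : gf T e c f -> gf T e (fun x => m%:R * c x) (m%:R * f).
Proof.
move=> gff n; have [s [us es fn]] := gff n; exists s; split=> //.
by rewrite fcoef_natM fn mulr_sumr.
Qed.

Lemma gf_opp e c f : gf T e c f -> gf T e (fun x => - c x) (- f).
Proof.
move=> gff n; have [s [us es fn]] := gff n; exists s; split=> //.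
by rewrite fcoefN fn sumrN.
Qed.

Lemma gf_dil d e c f : (0 < d)%N ->
  gf T e c f -> gf T (fun x => d * e x)%N c (dil d f).
Proof.
move=> d0 gff n; case: (boolP (d %| n)%N) => [/dvdnP[m ->]|dn].
  have [s [us es fm]] := gff m; exists s; split=> //.
    by move=> x; rewrite mulnC => /eqP; rewrite eqn_pmul2r // => /eqP/es.
  rewrite /= dvdn_mull // mulnK // fm; apply: eq_bigl => x.
  by rewrite mulnC eqn_pmul2r.
exists [::]; split=> //; last by rewrite big_nil /= (negPf dn).
by move=> x en; rewrite -en dvdn_mulr in dn.
Qed.

Lemma gf_fD e c f : gf T e c f -> gf T e (fun x => (e x)%:R * c x) (fD f).
Proof.
move=> gff n; have [s [us es fn]] := gff n; exists s; split=> //.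
by rewrite /= fn mulr_sumr; apply: eq_bigr => x /eqP ->.
Qed.

(** Only points of nonzero weight have to be hit by h. Congruence conditions on the summation
    variables enter in this way. *)
Lemma gf_reindex (h : T' -> T) (h' : T -> T') e c f : cancel h h' ->
    (forall x, c x != 0 -> h (h' x) = x) ->
  gf T e c f -> gf T' (e \o h) (c \o h) f.
Proof.
move=> hK h'K gff n; have [s [us es fn]] := gff n.
exists (undup (map h' s)); split; first exact: undup_uniq.
  by move=> x /es hs; rewrite mem_undup -[x]hK map_f.
rewrite -(big_map h (fun y => e y == n) c); apply: gf_coef gff _ _.
  by rewrite map_inj_uniq ?undup_uniq //; exact: can_inj hK.
by move=> x /es xs /h'K <-; rewrite map_f // mem_undup map_f.
Qed.

Lemma gf_mk e c (s : nat -> seq T) : (forall n, uniq (s n)) ->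
    (forall x, x \in s (e x)) ->
  gf T e c (Fps (fun n => \sum_(x <- s n | e x == n) c x)).
Proof.
by move=> us es n; exists (s n); split=> // x <-.
Qed.

End GeneratingFunctions.

Arguments gf {T}.
Arguments gf_coef {T e c f}.
Arguments gf_box {T e c f}.
Arguments gf_uniq {T e c f g}.
Arguments gf_eq {T e e' c c' f}.
Arguments gf_add {T e c c' f g}.
Arguments gf_scale {T e c} m {f}.
Arguments gf_opp {T e c f}.
Arguments gf_dil {T} d {e c f}.
Arguments gf_fD {T e c f}.
Arguments gf_reindex {T T'} h h' {e c f}.
Arguments gf_mk {T}.

(** Reindexing by h gives f = - f. *)
Lemma gf_antisym (T : eqType) (h : T -> T) e c f : involutive h ->
    e \o h =1 e -> (forall x, c (h x) = - c x) -> gf e c f -> f = 0.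
Proof.
move=> hK eh ch gff.
have gf1 := gf_reindex h h hK (fun x _ => hK x) gff.
have := gf_opp gff; move/(gf_eq (fun x => esym (eh x)) (fun x => esym (ch x))).
move/(gf_uniq gf1) => fN.
apply/fpsP => n; have /fpsP/(_ n) := fN; rewrite fcoefN fcoef0; lra.
Qed.

Lemma gf_mul (T T' : eqType) (e : T -> nat) (e' : T' -> nat) c c' f g :
    gf e c f -> gf e' c' g ->
  gf (fun x => e x.1 + e' x.2)%N (fun x => c x.1 * c' x.2) (f * g).
Proof.
move=> gff gfg n; have [s [us es]] := gf_box n gff.
have [t [ut et]] := gf_box n gfg.
exists [seq (x, y) | x <- s, y <- t]; split.
- by apply: allpairs_uniq => // -[? ?] [? ?].
- by move=> [x y] /= exy; rewrite allpairs_f ?es ?et //; lia.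
rewrite fcoefM [RHS]big_mkcond big_allpairs /=.
(* The condition e x + e' y = n is split according to the value i of e x, to match the Cauchy
   product. *)
pose F (i : 'I_n.+1) x y := if (e x == i) && (e' y == n - i)%N then c x * c' y else 0.
transitivity (\sum_(x <- s) \sum_(y <- t) \sum_(i < n.+1) F i x y).
  transitivity (\sum_(i < n.+1) \sum_(x <- s) \sum_(y <- t) F i x y); last first.
    by rewrite exchange_big; apply: eq_bigr => x _; rewrite exchange_big.
  apply: eq_bigr => i _; have := ltn_ord i => ltin.
  rewrite (gf_coef i s gff) //; last by move=> x ex _; apply: es; lia.
  rewrite (gf_coef (n - i) t gfg) //; last by move=> x ex _; apply: et; lia.
  rewrite mulr_suml big_mkcond /=; apply: eq_bigr => x _; rewrite /F.
  case: eqP => _ /=; last by rewrite big1.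
  by rewrite mulr_sumr big_mkcond.
apply: eq_bigr => x _; apply: eq_bigr => y _; rewrite /F.
case: eqP => exy; last first.
  by rewrite big1 // => i _; case: andP => // -[/eqP ? /eqP ?]; have := ltn_ord i; lia.
have lt : (e x < n.+1)%N by lia.
rewrite (bigD1 (Ordinal lt)) //= eqxx.
have -> : (n - e x)%N = e' y by lia.
rewrite eqxx /= big1 ?addr0 //.
by move=> i /eqP nei; case: eqP => // ei; case: nei; apply/val_inj.
Qed.

Lemma gf_union (T T' : eqType) (e : T -> nat) (e' : T' -> nat) c c' f g :
    gf e c f -> gf e' c' g ->
  gf (fun x => match x with inl y => e y | inr y => e' y end)
     (fun x => match x with inl y => c y | inr y => c' y end) (f + g).
Proof.
move=> gff gfg n; have [s [us es fn]] := gff n; have [t [ut et gn]] := gfg n.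
exists (map inl s ++ map inr t); split.
- rewrite cat_uniq !map_inj_uniq ?us ?ut ?andbT //=; try by move=> ? ? [].
  by apply/hasPn => _ /mapP[x _ ->]; apply/mapP => -[].
- by case=> x ex; rewrite mem_cat ?map_f ?orbT // ?es ?et.
by rewrite fcoefD fn gn big_cat /= !big_map.
Qed.

Arguments gf_mul {T T' e e' c c' f g}.
Arguments gf_union {T T' e e' c c' f g}.
Arguments gf_antisym {T} h {e c f}.

(** * Theta series and Lambert series *)

Definition irange (n : nat) : seq int := [seq i%:Z - n%:Z | i <- iota 0 (2 * n).+1].

Lemma mem_irange n x : (x \in irange n) = (`|x| <= n)%N.
Proof.
apply/mapP/idP => [[i]|xn]; first by rewrite mem_iota => ? ->; lia.
by exists `|(x + n%:Z)%R|%N; [rewrite mem_iota; lia | lia].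
Qed.

Lemma irange_uniq n : uniq (irange n).
Proof. by rewrite map_inj_uniq ?iota_uniq // => i j; lia. Qed.

Definition sgi (m : int) : rat := (-1) ^+ `|m|.

Lemma sgiE m : sgi m = if odd `|m| then -1 else 1.
Proof. by rewrite /sgi -signr_odd; case: odd; rewrite ?expr1. Qed.

Lemma sgiD m n : sgi (m + n) = sgi m * sgi n.
Proof.
rewrite !sgiE; have -> : odd `|(m + n)%R| = odd `|m| (+) odd `|n| by lia.
by do 2![case: odd => //=]; rewrite ?mulrNN mulr1.
Qed.

Lemma sgiN m : sgi (- m) = sgi m.
Proof. by rewrite /sgi abszN. Qed.

(** The sum of c(m) q^(m^2) over all integers m; the range [-n, n] suffices because |m| <= m^2. *)
Definition theta (c : int -> rat) :=
  Fps (fun n => \sum_(m <- irange n | (`|m| ^ 2 == n)%N) c m).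

Lemma gf_theta c : gf (fun m => `|m| ^ 2)%N c (theta c).
Proof.
apply: (gf_mk _ _ irange); first exact: irange_uniq.
by move=> x; rewrite mem_irange; nia.
Qed.

(** These are theta_3(q) = phi(q) and theta_4(q) = phi(-q). *)
Definition phi := theta (fun=> 1).
Definition phiN := theta sgi.

(** The weight 1 + (-1)^(a+b) keeps, doubled, the pairs of equal parity; they are the pairs (x + y,
    x - y), of square sum 2 (x^2 + y^2). *)
Lemma phi_sq : phi ^+ 2 + phiN ^+ 2 = 2%:R * dil 2 (phi ^+ 2).
Proof.
have g1 : gf _ _ phi := gf_theta _; have g2 : gf _ _ phiN := gf_theta _.
have := gf_add (gf_mul g1 g1) (gf_mul g2 g2).
move/(gf_reindex (fun x : int * int => (x.1 + x.2, x.1 - x.2))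
  (fun x => ((x.1 + x.2) %/ 2, (x.1 - x.2) %/ 2)%Z)).
have := gf_scale 2 (gf_dil 2 isT (gf_mul g1 g1)).
move/gf_eq => h1 h2; apply: gf_uniq (h2 _ _) (h1 _ _ _ _).
- by move=> [a b] /=; congr pair; lia.
- move=> [a b]; rewrite /= !sgiE => nz; congr pair => /=; move: nz; do 2!case: ifP; 
  rewrite ?mulr1 ?mulrNN ?addrN ?eqxx // => *; lia.
- by move=> [a b] /=; nia.
by move=> [a b] /=; rewrite !sgiD sgiN !sgiE; do 2!case: ifP => _; lra.
Qed.

(** Symmetrized, the weight is (-1)^a + (-1)^b, which vanishes unless a and b have equal parity; on
    (x + y, x - y) it equals 2 (-1)^(x+y). *)
Lemma phi_phiN : phi * phiN = dil 2 (phiN ^+ 2).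
Proof.
have g1 : gf _ _ phi := gf_theta _; have g2 : gf _ _ phiN := gf_theta _.
apply: (@fmulI 2%:R); first exact: fnat_neq0.
have -> : 2%:R * (phi * phiN) = phi * phiN + phiN * phi by ring.
have := gf_add (gf_mul g1 g2) (gf_mul g2 g1).
move/(gf_reindex (fun x : int * int => (x.1 + x.2, x.1 - x.2))
  (fun x => ((x.1 + x.2) %/ 2, (x.1 - x.2) %/ 2)%Z)).
have := gf_scale 2 (gf_dil 2 isT (gf_mul g2 g2)).
move/gf_eq => h1 h2; apply: gf_uniq (h2 _ _) (h1 _ _ _ _).
- by move=> [a b] /=; congr pair; lia.
- move=> [a b]; rewrite /= !sgiE => nz; congr pair => /=; move: nz; do 2!case: ifP; 
  rewrite ?mulr1 ?mul1r ?addrN ?addNr ?eqxx // => *; lia.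
- by move=> [a b] /=; nia.
by move=> [a b] /=; rewrite !sgiD sgiN !sgiE; do 2!case: ifP => _; lra.
Qed.

(** The weight 1 + (-1)^m keeps the even m = 2 a, with m^2 = 4 a^2. *)
Lemma phi_even : phi + phiN = 2%:R * dil 4 phi.
Proof.
have g1 : gf _ _ phi := gf_theta _; have g2 : gf _ _ phiN := gf_theta _.
have := gf_add g1 g2.
move/(gf_reindex (fun x : int => 2 * x) (fun x => (x %/ 2)%Z)).
have := gf_scale 2 (gf_dil 4 isT g1).
move/gf_eq => h1 h2; apply: gf_uniq (h2 _ _) (h1 _ _ _ _).
- by move=> a; lia.
- by move=> a; rewrite sgiE; case: ifP; rewrite ?addrN ?eqxx // => *; lia.
- by move=> a /=; nia.
by move=> a /=; rewrite sgiE; case: ifP => [|_]; [lia|lra].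
Qed.

(* [lambert k] is \sum_(j >= 1) j^k q^j / (1 - q^(2j)), indexed by
   (j - 1, (d - 1) / 2) with d odd and exponent j d. *)
Definition lambert k := Fps (fun n =>
  \sum_(x <- [seq (j, d) | j <- iota 0 n, d <- iota 0 n] |
          (x.1.+1 * (2 * x.2).+1 == n)%N) x.1.+1%:R ^+ k).

Lemma gf_lambert k : gf (fun x : nat * nat => x.1.+1 * (2 * x.2).+1)%N
  (fun x => x.1.+1%:R ^+ k) (lambert k).
Proof.
apply: (gf_mk _ _ (fun n => [seq (j, d) | j <- iota 0 n, d <- iota 0 n])).
  by move=> n; apply: allpairs_uniq; rewrite ?iota_uniq // => -[? ?] [? ?].
by move=> [j d]; apply: allpairs_f; rewrite mem_iota /=; nia.
Qed.

(* [divisors 0] is [[:: 1]], hence the separate case. *)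
Definition sigma k := Fps (fun n =>
  if n is 0 then 0 else (\sum_(d <- divisors n) d ^ k)%N%:R).

Lemma gf_sigma k : gf (fun x : nat * nat => x.1.+1 * x.2.+1)%N
  (fun x => x.1.+1%:R ^+ k) (sigma k).
Proof.
case=> [|n]; first by exists [::]; split=> //=; rewrite big_nil.
exists [seq (d.-1, (n.+1 %/ d).-1) | d <- divisors n.+1]; split.
- rewrite map_inj_in_uniq ?divisors_uniq // => d d'.
  rewrite -!dvdn_divisors // => /(dvdn_gt0 (ltn0Sn n)) d0.
  by move=> /(dvdn_gt0 (ltn0Sn n)) d0' [e _]; lia.
- move=> [j d] /= e; apply/mapP; exists j.+1; last by rewrite -e mulKn.
  by rewrite -dvdn_divisors // -e dvdn_mulr.
rewrite -[LHS]/((\sum_(d <- divisors n.+1) d ^ k)%N%:R) natr_sum big_map.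
rewrite big_seq_cond [RHS]big_seq_cond.
apply: eq_big => [d|d /andP[+ _]]; rewrite -dvdn_divisors // ; last first.
  by move/(dvdn_gt0 (ltn0Sn n)) => d0; rewrite prednK ?d0 // natrX.
case: (boolP (d %| n.+1)%N) => // dn; have d0 := dvdn_gt0 (ltn0Sn n) dn.
have q0 : (0 < n.+1 %/ d)%N by rewrite divn_gt0 // dvdn_leq.
by rewrite (prednK d0) (prednK q0) mulnC (divnK dn) eqxx.
Qed.

(** Factorizations n = j d are split by the parity of the cofactor d, the weight j^k being
    unaffected. *)
Lemma sigma_odd_part k : lambert k + dil 2 (sigma k) = sigma k.
Proof.
have := gf_union (gf_lambert k) (gf_dil 2 isT (gf_sigma k)).
move/(gf_reindex (fun x : nat * nat =>
    if odd x.2 then inr (x.1, x.2./2) else inl (x.1, x.2./2))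
  (fun x => match x with inl y => (y.1, 2 * y.2)%N
                       | inr y => (y.1, (2 * y.2).+1) end)) => h.
apply: gf_uniq (gf_eq _ _ (h _ _)) (gf_sigma k).
- by move=> [a b] /=; case: ifP => /=; nia.
- by move=> [a b] /=; case: ifP.
- by move=> [a b] /=; case: ifP => /= ob; congr pair; lia.
move=> [[a b]|[a b]] _ /=.
  by rewrite mul2n odd_double doubleK.
by rewrite mul2n odd_double /= uphalf_double.
Qed.

(** * The logarithmic derivative of the theta function *)

Lemma sum_involution (T : eqType) (s : seq T) (F : T -> rat) (h : T -> T) :
    uniq s -> involutive h -> (forall x, F x != 0 -> x \in s) ->
    (forall x, F (h x) != 0 -> x \in s) ->
  \sum_(x <- s) F (h x) = \sum_(x <- s) F x.
Proof.
move=> us hK Fs Fhs; rewrite -(big_map h xpredT F); apply: cover_sum => //.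
  by rewrite map_inj_uniq //; exact: inv_inj.
by move=> x; rewrite -{1}[x]hK => /Fhs hs; rewrite -[x]hK map_f.
Qed.

Lemma mem_pairs (T T' : eqType) (s : seq T) (t : seq T') x y :
  ((x, y) \in [seq (x, y) | x <- s, y <- t]) = (x \in s) && (y \in t).
Proof.
apply/allpairsPdep/andP => [[x' [y' [xs yt [-> ->]]]] // | [xs yt]].
by exists x, y.
Qed.

(** What is left of the condition c > - 2 n after antisymmetrization in n: for n > 0 the indicator
    of - 2 n < c <= 2 n. *)
Definition side (n c : int) : rat :=
  (if - (2 * n) < c then 1 else 0) - (if 2 * n < c then 1 else 0).

Lemma sideN n c : side (- n) c = - side n c.
Proof. by rewrite /side mulrN opprK opprB. Qed.

(** An odd c avoids the endpoints of the interval, which is therefore symmetric. *)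
Lemma side_opp n c : odd `|c| -> side n (- c) = side n c.
Proof.
by move=> oc; rewrite /side; do ![case: ifP => ?]; rewrite ?subr0 ?subrr //; lia.
Qed.

Lemma side_eq0 n c : odd `|c| -> side n c != 0 -> (`|c| < 2 * `|n|)%N.
Proof.
by move=> oc; rewrite /side; do 2!case: ifP => ?; rewrite ?subrr ?eqxx //; lia.
Qed.

(** For n >= 0 there are 2 n odd integers between - 2 n and 2 n, namely 2 i + 1 - 2 n for i < 2 n;
    oddness in n gives the rest. *)
Lemma sum_side n N : (2 * `|n| <= N)%N ->
  \sum_(c <- irange N | odd `|c|) side n c = 2%:R * n%:~R.
Proof.
wlog n0 : n / 0 <= n => [wl nN|nN].
  have [/wl/(_ nN) //|n0] := lerP 0 n.
  have /wl : 0 <= - n by lia.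
  rewrite abszN => /(_ nN); under eq_bigr do rewrite sideN.
  by rewrite sumrN rmorphN /= => e; lra.
transitivity (\sum_(c <- [seq (2 * i).+1%:Z - 2 * n | i <- iota 0 (2 * `|n|)])
    (if odd `|c| && (- (2 * n) < c) && (c < 2 * n) then 1 else 0 : rat)).
  rewrite big_mkcond; under eq_bigr => c _.
    have -> : (if odd `|c| then side n c else 0) =
      (if odd `|c| && (- (2 * n) < c) && (c < 2 * n) then 1 else 0).
      by rewrite /side; do ![case: ifP => ?]; rewrite ?subr0 ?subrr //; lia.
    over.
  apply: cover_sum; first exact: irange_uniq.
  - by rewrite map_inj_uniq ?iota_uniq // => i j; lia.
  - by move=> c; rewrite mem_irange; case: ifP; rewrite ?eqxx //; lia.
  move=> c; case: ifP; rewrite ?eqxx // => cn _; apply/mapP.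
  by exists `|((c + 2 * n) %/ 2)%Z|%N; rewrite ?mem_iota; lia.
rewrite big_map big_seq (eq_bigr (fun=> 1)) => [|i]; last first.
  by rewrite mem_iota; case: ifP => //; lia.
rewrite -big_seq big_const_seq count_predT size_iota iter_addr addr0.
by rewrite natrM -[n in RHS]gez0_abs.
Qed.

Lemma absz_le_sqr (x : int) (N : nat) : x ^+ 2 <= N%:Z -> (`|x| <= N)%N.
Proof. by move=> h; nia. Qed.

(* Writing n = m + j and c = d - 2 n turns m^2 + j d = N into n^2 + c j + j^2 = N,
   with j > 0 and c > - 2 n.  Since the summand is odd in n, replacing n by - n turns
   the condition c > - 2 n into the weight [side n c], up to a factor 2; the symmetry
   (j, c) -> (- j, - c) then extends the sum to all j <> 0.  The sum over all j
   vanishes, because j -> - c - j changes the sign (c is odd), so that only the terms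
   with j = 0 contribute. *)
Section LogDerivative.
Variables (N k : nat).
Hypothesis odd_k : odd k.

(** The sign is that of m = n - j, and n = m + j is the quantity raised to the power k. *)
Let G (n j c : int) : rat :=
  if odd `|c| && (n ^+ 2 + c * j + j ^+ 2 == N%:Z) then sgi (n + j) * n%:~R ^+ k
  else 0.

Let G_flip_n n j c : G (- n) j c = - G n j c.
Proof.
rewrite /G sqrrN; case: ifP => _; last by rewrite oppr0.
by rewrite !sgiD sgiN rmorphN /= exprNn -signr_odd odd_k expr1; ring.
Qed.

Let G_flip_jc n j c : G n (- j) (- c) = G n j c.
Proof. by rewrite /G abszN sqrrN mulrNN !sgiD sgiN. Qed.

Let G_reflect n j c : G n (- c - j) c = - G n j c.
Proof.
rewrite /G; have -> : n ^+ 2 + c * (- c - j) + (- c - j) ^+ 2 =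
  n ^+ 2 + c * j + j ^+ 2 by ring.
case: ifP => [/andP[oc _]|_]; last by rewrite oppr0.
by rewrite !sgiD !sgiN [sgi c]sgiE oc; ring.
Qed.

Let K := (6 * N + 1)%N.
Let B := [seq (n, x) | n <- irange K, x <- [seq (j, c) | j <- irange K, c <- irange K]].

Let B_uniq : uniq B.
Proof.
apply: allpairs_uniq; [exact: irange_uniq | | by case=> ? ? []].
by apply: allpairs_uniq; [exact: irange_uniq | exact: irange_uniq | case=> ? ? []].
Qed.

Let mem_B n j c : ((n, (j, c)) \in B) = [&& `|n| <= K, `|j| <= K & `|c| <= K]%N.
Proof.
by rewrite /B !mem_pairs !mem_irange.
Qed.

Let G_side_B n j c : side n c * G n j c != 0 -> (n, (j, c)) \in B.
Proof.
rewrite mulf_eq0 negb_or => /andP[sn]; rewrite /G; case: ifP; rewrite ?eqxx //.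
move=> /andP[oc /eqP e] _; have cn := side_eq0 _ _ oc sn; rewrite mem_B /K.
(* Completing the square. As |c| < 2 |n|, the second term is at least 4 |n| - 1, which bounds n,
   hence c, and then j. *)
have n4 : (2 * j + c) ^+ 2 + (4 * n ^+ 2 - c ^+ 2) = 4 * N%:Z by rewrite -e; ring.
have h : 4 * `|n|%:Z - 1 <= 4 * n ^+ 2 - c ^+ 2 by nia.
have h1 : (2 * j + c) ^+ 2 <= (4 * N)%N%:Z by nia.
have h2 : (`|n| <= N)%N by have := sqr_ge0 (2 * j + c); lia.
have h3 := absz_le_sqr _ _ h1; clear -cn h2 h3; lia.
Qed.

Let sum_pos : \sum_(x <- B) (if 0 < x.2.1 then side x.1 x.2.2 * G x.1 x.2.1 x.2.2 else 0)
  = - \sum_(n <- irange K | (`|n| ^ 2 == N)%N) sgi n * n%:~R ^+ k.+1.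
Proof.
set T := LHS; set Th := (X in - X).
have Tneg : T = \sum_(x <- B)
    (if x.2.1 < 0 then side x.1 x.2.2 * G x.1 x.2.1 x.2.2 else 0).
  rewrite /T -(sum_involution _ B _ (fun x => (x.1, (- x.2.1, - x.2.2)))) //.
  - apply: eq_bigr => -[n [j c]] _ /=; rewrite oppr_gt0 G_flip_jc.
    case: (boolP (odd `|c|)) => [oc|/negPf oc]; first by rewrite side_opp.
    by rewrite /G oc !mulr0 !if_same.
  - by move=> [n [j c]] /=; rewrite !opprK.
  - by move=> [n [j c]] /=; case: ifP; rewrite ?eqxx // => _ /G_side_B.
  - move=> [n [j c]] /=; case: ifP; rewrite ?eqxx // => _ /G_side_B.
    by rewrite !mem_B !abszN.
have zero : \sum_(x <- B) side x.1 x.2.2 * G x.1 x.2.1 x.2.2 = 0.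
  set Z := LHS; have : Z = - Z; last by lra.
  rewrite {1}/Z -(sum_involution _ B _ (fun x => (x.1, (- x.2.2 - x.2.1, x.2.2)))) //.
  - by rewrite -sumrN; apply: eq_bigr => -[n [j c]] _ /=; rewrite G_reflect mulrN.
  - by move=> [n [j c]] /=; rewrite opprB addrCA subrr addr0.
  - by move=> [n [j c]] /= /G_side_B.
  - by move=> [n [j c]] /=; rewrite G_reflect mulrN oppr_eq0 => /G_side_B.
(* For j = 0 the equation is n^2 = N, and the weights over odd c add up to 2 n, which raises the
   exponent k to k + 1. *)
have mid : \sum_(x <- B)
    (if x.2.1 == 0 then side x.1 x.2.2 * G x.1 x.2.1 x.2.2 else 0) = 2%:R * Th.
  rewrite /B big_allpairs /Th [X in _ = _ * X]big_mkcond mulr_sumr; apply: eq_bigr => n _.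
  rewrite big_allpairs (bigD1_seq 0) ?irange_uniq ?mem_irange //= [X in _ + X]big1.
    have G0 c : G n 0 c = if odd `|c| && (`|n| ^ 2 == N)%N then sgi n * n%:~R ^+ k else 0.
      rewrite /G mulr0 expr0n /= !addr0.
      by have -> : (n ^+ 2 == N%:Z) = (`|n| ^ 2 == N)%N by apply/eqP/eqP; nia.
    under eq_bigr do rewrite G0.
    rewrite addr0; case: eqP => [nN|_]; last first.
      by rewrite mulr0 big1 // => c _; rewrite andbF mulr0.
    transitivity (\sum_(c <- irange K | odd `|c|) side n c * (sgi n * n%:~R ^+ k)).
      rewrite [RHS]big_mkcond; apply: eq_bigr => c _.
      by rewrite andbT; case: ifP => //; rewrite mulr0.
    rewrite -mulr_suml sum_side; first by rewrite exprS; ring.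
    by rewrite /K; nia.
  by move=> j /negPf ->; rewrite big1.
have : T + T + 2%:R * Th = 0; last by lra.
rewrite {2}Tneg {1}/T -mid -[RHS]zero -!big_split; apply: eq_bigr => -[n [j c]] _ /=.
by case: ltgtP; rewrite ?addr0 ?add0r.
Qed.

Lemma theta_logder_coef M :
    gf (fun x : int * (nat * nat) => `|x.1| ^ 2 + x.2.1.+1 * (2 * x.2.2).+1)%N
       (fun x => sgi x.1 * (x.1 + x.2.1.+1%:Z)%:~R ^+ k) M ->
  2%:R * M@_N = - (theta (fun m => sgi m * m%:~R ^+ k.+1))@_N.
Proof.
rewrite (gf_coef N (irange K) (gf_theta _)) ?irange_uniq //; last first.
  by move=> m mN _; rewrite mem_irange /K; nia.
rewrite -sum_pos => gM; have [s [us es ->]] := gM N.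
pose F (x : int * (int * int)) :=
  if (0 < x.2.1) && (- (2 * x.1) < x.2.2) then G x.1 x.2.1 x.2.2 else 0.
have FB x : F x != 0 -> x \in B.
  case: x => n [j c]; rewrite /F /= /G; case: ifP; rewrite ?eqxx // => /andP[j0 cn].
  case: ifP; rewrite ?eqxx // => /andP[oc /eqP e] _; rewrite mem_B /K.
  (* The original equation m^2 + j d = N with d = c + 2 n; as j and d are positive, it bounds all
     variables. *)
  have e' : (n - j) ^+ 2 + j * (c + 2 * n) = N%:Z by rewrite -e; ring.
  have h1 : (n - j) ^+ 2 <= N%:Z by nia.
  have h2 : j * (c + 2 * n) <= N%:Z by nia.
  have h3 : j <= N%:Z by nia.
  have h4 : c + 2 * n <= N%:Z by nia.
  have h5 := absz_le_sqr _ _ h1.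
  by apply/and3P; split; lia.
have -> : \sum_(x <- s | (`|x.1| ^ 2 + x.2.1.+1 * (2 * x.2.2).+1 == N)%N)
    sgi x.1 * (x.1 + x.2.1.+1%:Z)%:~R ^+ k = \sum_(x <- B) F x.
  pose h (x : int * (nat * nat)) := let n := x.1 + x.2.1.+1%:Z in
    (n, (x.2.1.+1%:Z, (2 * x.2.2).+1%:Z - 2 * n)).
  transitivity (\sum_(x <- map h s) F x).
    rewrite big_map big_mkcond; apply: eq_bigr => -[m [j d]] _.
    rewrite /F /G /h /=; set n := m + _; set c := _ - _.
    have -> : - (2 * n) < c by rewrite /c; lia.
    have -> : odd `|c| by rewrite /c; lia.
    rewrite /=; have -> : n ^+ 2 + c * j.+1 + j.+1%:Z ^+ 2 =
      (`|m| ^ 2 + j.+1 * (2 * d).+1)%N%:Z by rewrite /n /c; nia.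
    rewrite eqz_nat; case: ifP => // _; congr (_ * _).
    by rewrite /n !sgiD -mulrA -sgiD [sgi (_ + _)]sgiE; case: ifP; rewrite ?mulr1 //; lia.
  apply: cover_sum => //.
    by rewrite map_inj_uniq // => -[m [j d]] [m' [j' d']] [*]; congr (_, (_, _)); lia.
  case=> n [j c] Fx; apply/mapP; exists (n - j, (`|j|.-1, `|(c + 2 * n)%R|./2)%N).
    apply: es; move: Fx; rewrite /F /G /=; case: ifP; rewrite ?eqxx // => /andP[j0 cn].
    case: ifP; rewrite ?eqxx // => /andP[oc /eqP e] _.
    have e' : (n - j) ^+ 2 + j * (c + 2 * n) = N%:Z by rewrite -e; ring.
    have -> : `|j|.-1.+1 = `|j|%N by lia.
    have -> : (2 * `|(c + 2 * n)%R|./2).+1 = `|(c + 2 * n)%R|%N by lia.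
    nia.
  move: Fx; rewrite /F /G /=; case: ifP; rewrite ?eqxx // => /andP[j0 cn].
  case: ifP; rewrite ?eqxx // => /andP[oc _] _.
  by rewrite /h /=; congr (_, (_, _)); lia.
(* One of the two copies is taken at - n; since G is odd in n, the two conditions on c combine to
   [side]. *)
rewrite mulr_natl mulr2n -{1}(sum_involution _ B _ (fun x => (- x.1, x.2))) //.
- rewrite -big_split; apply: eq_bigr => -[n [j c]] _ /=.
  rewrite /F /= G_flip_n /side mulrN opprK; case: (0 < j) => /=; last by rewrite addr0.
  by do 2!case: ifP => _; ring.
- by case=> n [j c] /=; rewrite opprK.
- by case=> n [j c] /FB; rewrite !mem_B abszN.
Qed.

End LogDerivative.

(** * Moments of theta_4 and Lambert series *)

Definition phiN_moment k := theta (fun m => sgi m * m%:~R ^+ k).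

Lemma phiN_moment0 : phiN_moment 0 = phiN.
Proof. by congr theta; apply/funext => m; rewrite mulr1. Qed.

Lemma phiN_moment_odd k : odd k -> phiN_moment k = 0.
Proof.
move=> ok; apply: (gf_antisym (fun m => - m) _ _ _ (gf_theta _)).
- exact: opprK.
- by move=> m /=; rewrite abszN.
by move=> m; rewrite sgiN rmorphN /= exprNn -signr_odd ok expr1; ring.
Qed.

(** The exponent of q is m^2, so D multiplies by m^2. *)
Lemma fD_phiN_moment k : fD (phiN_moment k) = phiN_moment k.+2.
Proof.
apply: gf_uniq (gf_eq _ _ (gf_fD (gf_theta _))) (gf_theta _) => // m.
have -> : (`|m| ^ 2)%:R = m%:~R ^+ 2 :> rat.
  by rewrite -rmorphXn pmulrn; congr (_%:~R); nia.
by rewrite [in RHS]exprS [in RHS]exprS; ring.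
Qed.

Lemma gf_sum (T : eqType) (e : T -> nat) n (c : nat -> T -> rat) (F : nat -> fps) :
    (forall i, gf e (c i) (F i)) ->
  gf e (fun x => \sum_(i < n.+1) c i x) (\sum_(i < n.+1) F i).
Proof.
move=> gF; elim: n => [|n IH].
  by rewrite big_ord1; apply: gf_eq (gF 0%N) => // x; rewrite big_ord1.
by rewrite big_ord_recr; apply: gf_eq (gf_add IH (gF n.+1)) => // x;
  rewrite [RHS]big_ord_recr.
Qed.

(** The binomial expansion of (m + j)^k in [theta_logder_coef] puts the powers of m into the moments
    and those of j into the Lambert series. *)
Lemma theta_logder k : odd k ->
  2%:R * \sum_(i < k.+1) 'C(k, i)%:R * (phiN_moment (k - i) * lambert i)
    = - phiN_moment k.+1.
Proof.
move=> ok; apply/fpsP => N; rewrite fcoef_natM; apply: theta_logder_coef => //.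
have := gf_sum _ _ k _ _ (fun i => gf_scale 'C(k, i)
  (gf_mul (gf_theta (fun m => sgi m * m%:~R ^+ (k - i))) (gf_lambert i))).
apply: gf_eq => // -[m [j d]] /=.
rewrite rmorphD exprDn mulr_sumr; apply: eq_bigr => i _.
by rewrite mulr_natl -!mulrnAr mulrA.
Qed.

(** In this and the next two lemmas only odd i contribute, because odd moments vanish. *)
Lemma phiN_moment2 : phiN_moment 2 = - 2%:R * (phiN * lambert 1).
Proof.
have := theta_logder 1 isT; rewrite !big_ord_recr big_ord0 /= add0r.
rewrite (phiN_moment_odd 1) // phiN_moment0 binn => e.
by apply: oppr_inj; rewrite -e; ring.
Qed.

Lemma phiN_moment4 : phiN_moment 4 =
  - 2%:R * (phiN * lambert 3 + 3%:R * (phiN_moment 2 * lambert 1)).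
Proof.
have := theta_logder 3 isT; rewrite !big_ord_recr big_ord0 /= add0r.
rewrite (phiN_moment_odd 1) // (phiN_moment_odd 3) // phiN_moment0 bin1 binn => e.
by apply: oppr_inj; rewrite -e; ring.
Qed.

Lemma phiN_moment6 : phiN_moment 6 =
  - 2%:R * (phiN * lambert 5 + 10%:R * (phiN_moment 2 * lambert 3) +
            5%:R * (phiN_moment 4 * lambert 1)).
Proof.
have := theta_logder 5 isT; rewrite !big_ord_recr big_ord0 /= add0r.
rewrite (phiN_moment_odd 1) // (phiN_moment_odd 3) // (phiN_moment_odd 5) //.
rewrite phiN_moment0 bin1 binn.
have -> : 'C(5, 3) = 10%N by [].
by move=> e; apply: oppr_inj; rewrite -e; ring.
Qed.

(** * Theta constants *)

Notation del := (dil 2).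

Lemma delM f g : del (f * g) = del f * del g. Proof. exact: dilM. Qed.
Lemma delX f n : del (f ^+ n) = del f ^+ n. Proof. exact: dilX. Qed.
Lemma del_nat n : del n%:R = n%:R. Proof. exact: dil_nat. Qed.
Lemma del1 : del 1 = 1. Proof. exact: dil1. Qed.
Lemma fD_del f : fD (del f) = 2%:R * del (fD f). Proof. exact: fD_dil. Qed.
Lemma fD_coef f n : (fD f)@_n = n%:R * f@_n. Proof. by []. Qed.
Definition delE := (del_nat, dilD, dilN, delM, delX, del1).

Lemma fcoefM1 f g : (f * g)@_1 = f@_0 * g@_1 + f@_1 * g@_0.
Proof. by rewrite fcoefM !big_ord_recl big_ord0 addr0. Qed.

(* theta_3(q^4) and theta_2(q^4), so that theta_3(q) = th3 + th2 and
   theta_4(q) = th3 - th2.  Both are locked because unification would otherwise see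
   the sum behind th2 when rewriting with additivity or multiplicativity. *)
Definition th3 : fps := locked (dil 4 phi).
Definition th2 : fps := locked (phi - th3).

Lemma th3E : th3 = dil 4 phi. Proof. by rewrite /th3 -lock. Qed.
Lemma th2E : th2 = phi - th3. Proof. by rewrite /th2 -lock. Qed.

Lemma phiE : phi = th3 + th2. Proof. by rewrite th2E; ring. Qed.
Lemma phiNE : phiN = th3 - th2.
Proof. by rewrite -[LHS](addKr phi) phi_even th2E th3E; ring. Qed.

(** * Doubling formulas and derivatives of the theta constants *)

Lemma phi_del_sq : (del th3 + del th2) ^+ 2 = th3 ^+ 2 + th2 ^+ 2.
Proof.
apply: (@fmulI 2%:R); first exact: fnat_neq0.
by have := phi_sq; rewrite delX phiNE phiE !delE => <-; ring.
Qed.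

Lemma phiN_del_sq : (del th3 - del th2) ^+ 2 = th3 ^+ 2 - th2 ^+ 2.
Proof. by have := phi_phiN; rewrite delX phiNE phiE !delE => <-; ring. Qed.

Lemma th3_sq : th3 ^+ 2 = del th3 ^+ 2 + del th2 ^+ 2.
Proof.
apply: (@fmulI 2%:R); first exact: fnat_neq0.
transitivity ((th3 ^+ 2 + th2 ^+ 2) + (th3 ^+ 2 - th2 ^+ 2)); first by ring.
by rewrite -phi_del_sq -phiN_del_sq; ring.
Qed.

Lemma th2_sq : th2 ^+ 2 = 2%:R * (del th3 * del th2).
Proof.
apply: (@fmulI 2%:R); first exact: fnat_neq0.
transitivity ((th3 ^+ 2 + th2 ^+ 2) - (th3 ^+ 2 - th2 ^+ 2)); first by ring.
by rewrite -phi_del_sq -phiN_del_sq; ring.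
Qed.

(** Supplies initial data for the uniqueness lemmas: [th3] begins with 1 and [th2] with 2 q. *)
Lemma phi_low : phi@_0 = 1 /\ phi@_1 = 2.
Proof. by split; rewrite /= /irange /= !big_cons big_nil. Qed.

Lemma th3_0 : th3@_0 = 1. Proof. by rewrite th3E fcoef_dil0; case: phi_low. Qed.
Lemma th3_1 : th3@_1 = 0. Proof. by rewrite th3E. Qed.
Lemma th2_0 : th2@_0 = 0.
Proof. by rewrite th2E fcoefB th3_0; case: phi_low => -> _; rewrite subrr. Qed.
Lemma th2_1 : th2@_1 = 2.
Proof. by rewrite th2E fcoefB th3_1; case: phi_low => _ ->; rewrite subr0. Qed.
Lemma th32_0 : (th3 * th2)@_0 = 0. Proof. by rewrite fcoefM0 th2_0 mulr0. Qed.
Lemma th32_1 : (th3 * th2)@_1 = 2.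
Proof. by rewrite fcoefM1 th3_0 th2_1 th2_0 mulr0 addr0 mul1r. Qed.

Lemma wronskian : th3 * fD th2 - th2 * fD th3 = th3 * th2 * (th3 ^+ 4 - th2 ^+ 4).
Proof.
set W := LHS; set W' := RHS; apply/eqP; rewrite -subr_eq0; apply/eqP.
have DP : th3 * fD th3 = 2%:R * (del th3 * del (fD th3) + del th2 * del (fD th2)).
  apply: (@fmulI 2%:R); first exact: fnat_neq0.
  have := congr1 fD th3_sq; rewrite fDD !fDX !fD_del /= !expr1 => e.
  by rewrite mulrA e; ring.
have DS : th2 * fD th2 = 2%:R * (del th3 * del (fD th2) + del th2 * del (fD th3)).
  apply: (@fmulI 2%:R); first exact: fnat_neq0.
  have := congr1 fD th2_sq; rewrite fDX !fDM fD_nat !fD_del /= !expr1 => e.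
  by rewrite mulrA e; ring.
(* With x, y the images of [th3], [th2] under q -> q^2, both W and W' satisfy P S f = 2 (x^2 - y^2)
   f(q^2), and both begin with 2 q. *)
apply: (dil_uniq2 (th3 * th2) (2%:R * (del th3 ^+ 2 - del th2 ^+ 2))).
- exact: th32_0.
- by rewrite th32_1.
- by rewrite fcoefB /W /W' fcoefB !fcoefM0 th2_0 !fD_coef !(mulr0, mul0r) !subr0.
- have T0 : (th3 ^+ 4 - th2 ^+ 4)@_0 = 1 by rewrite fcoefB !fcoef_exp0 th3_0 th2_0; ring.
  have W1 : W@_1 = 2.
    by rewrite /W fcoefB !fcoefM1 !fD_coef th3_0 th3_1 th2_0 th2_1; ring.
  by rewrite fcoefB W1 /W' fcoefM1 th32_0 th32_1 T0; ring.
rewrite dilB mulrBr [RHS]mulrBr; congr (_ - _).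
  transitivity (th3 ^+ 2 * (th2 * fD th2) - th2 ^+ 2 * (th3 * fD th3));
    first by rewrite /W; ring.
  by rewrite DP DS th3_sq th2_sq /W !delE; ring.
transitivity (th3 ^+ 2 * th2 ^+ 2 * (th3 ^+ 2 ^+ 2 - th2 ^+ 2 ^+ 2));
  first by rewrite /W'; ring.
by rewrite th3_sq th2_sq /W' !delE; ring.
Qed.

Lemma fD_phiN : fD phiN = phiN * (- 2%:R * lambert 1).
Proof. by rewrite -phiN_moment0 fD_phiN_moment phiN_moment2 phiN_moment0; ring. Qed.

Lemma phiN_neq0 : phiN != 0.
Proof. by apply: (fps_neq0 _ 0); rewrite phiNE fcoefB th3_0 th2_0 subr0. Qed.

Lemma lambert0 k : (lambert k)@_0 = 0.
Proof. by rewrite /= big_nil. Qed.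

(** The logarithmic derivatives of [phiN] and, by [fD_th3], of [th3]. They differ by the Wronskian
    divided by [th3 * phiN]. *)
Definition dlog_phiN := - 2%:R * lambert 1.
Definition dlog_th3 := dlog_phiN + th2 * (th3 + th2) * (th3 ^+ 2 + th2 ^+ 2).

Lemma fD_th3 : fD th3 = th3 * dlog_th3.
Proof.
apply: (@fmulI phiN); first exact: phiN_neq0.
transitivity (th3 * fD phiN + (th3 * fD th2 - th2 * fD th3)).
  by rewrite phiNE fDB; ring.
by rewrite wronskian fD_phiN -/dlog_phiN phiNE /dlog_th3; ring.
Qed.

Lemma fD_th2 : fD th2 = th2 * (dlog_th3 + (th3 ^+ 4 - th2 ^+ 4)).
Proof.
have -> : fD th2 = fD th3 - fD phiN by rewrite phiNE fDB; ring.
by rewrite fD_phiN -/dlog_phiN fD_th3 phiNE /dlog_th3; ring.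
Qed.

(** The fourth moment is computed twice: by differentiating the second moment, and by
    [phiN_moment4]. *)
Lemma fD_dlog_phiN : fD dlog_phiN = - 2%:R * lambert 3 + 2%:R * dlog_phiN ^+ 2.
Proof.
apply: (@fmulI phiN); first exact: phiN_neq0.
have := fD_phiN_moment 2; rewrite phiN_moment4 phiN_moment2.
have -> : - 2%:R * (phiN * lambert 1) = phiN * dlog_phiN by rewrite /dlog_phiN; ring.
rewrite fDM fD_phiN -/dlog_phiN => /(canRL (addKr _)) ->.
by rewrite /dlog_phiN; ring.
Qed.

(** The sixth moment is computed twice. With F = - 2 [lambert 3], the right-hand side is phiN^8 D(F
    / phiN^8). *)
Lemma lambert5E : - 2%:R * lambert 5 =
  fD (- 2%:R * lambert 3) - 8%:R * dlog_phiN * (- 2%:R * lambert 3).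
Proof.
apply: (@fmulI phiN); first exact: phiN_neq0.
have := fD_phiN_moment 4; rewrite phiN_moment6 phiN_moment4 phiN_moment2.
set F := - 2%:R * lambert 3.
have -> : - 2%:R * (phiN * lambert 3 + 3%:R * (- 2%:R * (phiN * lambert 1) * lambert 1))
  = phiN * (F + 3%:R * dlog_phiN ^+ 2) by rewrite /dlog_phiN /F; ring.
rewrite (fDM phiN) (fDD F) (fDM 3%:R) fDX fD_nat fD_dlog_phiN fD_phiN -/dlog_phiN -/F /=
  expr1 => e.
transitivity (- 2%:R * (phiN * lambert 5 +
      10%:R * (- 2%:R * (phiN * lambert 1) * lambert 3) +
      5%:R * (phiN * (F + 3%:R * dlog_phiN ^+ 2) * lambert 1)) -
   phiN * dlog_phiN * (10%:R * F + 5%:R * (F + 3%:R * dlog_phiN ^+ 2))).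
  by rewrite /F /dlog_phiN; ring.
by rewrite -e; ring.
Qed.

(** Logarithmic differentiation of phiN(q^2)^2 = th3^2 - th2^2. *)
Lemma del_dlog_phiN : 2%:R * del dlog_phiN = dlog_th3 - th2 ^+ 2 * (th3 ^+ 2 + th2 ^+ 2).
Proof.
apply: (@fmulI (2%:R * del phiN ^+ 2)).
  apply: (fps_neq0 _ 0).
  by rewrite fcoef_natM fcoef_exp0 fcoef_dil0 phiNE fcoefB th3_0 th2_0.
have e : del phiN ^+ 2 = th3 ^+ 2 - th2 ^+ 2 by rewrite phiNE dilB phiN_del_sq.
have := congr1 fD e; rewrite fDB !fDX fD_del fD_th3 fD_th2 fD_phiN -/dlog_phiN /= !expr1
  => De.
transitivity (2%:R * del phiN * (2%:R * del (phiN * dlog_phiN))); first by rewrite delM;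
  ring.
by rewrite De e; ring.
Qed.

Lemma lambert3E : 2%:R * lambert 3 = th3 * th2 * (th3 ^+ 2 + th2 ^+ 2) * (th3 + th2) ^+ 4.
Proof.
set F := - 2%:R * lambert 3; set Fc := RHS.
have : F + Fc = 0; last first.
  by move/(canRL (addrK _)); rewrite sub0r /F mulNr => /oppr_inj.
(* Differentiating [del_dlog_phiN] relates F(q^2) to F; the factor 4 arises as its own 2 times the 2
   from D(f(q^2)) = 2 (D f)(q^2). *)
apply: (dil_uniq 4).
  by rewrite fcoefD /F /Fc !fcoefM0 lambert0 th2_0; ring.
have D1 : 4%:R * del F = F + 2%:R * dlog_phiN ^+ 2 - 2%:R * (2%:R * del dlog_phiN) ^+ 2
   + fD (th2 * (th3 + th2) * (th3 ^+ 2 + th2 ^+ 2)) - fD (th2 ^+ 2 * (th3 ^+ 2 +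
     th2 ^+ 2)).
  have -> : F = fD dlog_phiN - 2%:R * dlog_phiN ^+ 2 by rewrite fD_dlog_phiN -/F; ring.
  have := congr1 fD del_dlog_phiN;
    rewrite fDM fD_nat fD_del [in RHS]fDB /dlog_th3 [in RHS]fDD => e.
  transitivity ((0 * del dlog_phiN + 2%:R * (2%:R * del (fD dlog_phiN))) - 2%:R * (2%:R
    * del dlog_phiN) ^+ 2).
    by rewrite !delE; ring.
  by rewrite e; ring.
rewrite dilD mulrDr D1 del_dlog_phiN.
have -> : 4%:R * del Fc = th3 ^+ 2 * th2 ^+ 2 * (th3 ^+ 2 + th2 ^+ 2) ^+ 2 * 2%:R.
  by rewrite th3_sq th2_sq /Fc !delE; ring.
rewrite !(fDX, fDM, fDD, fD_nat, fD_th3, fD_th2) /= !expr1 /Fc.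
have -> : dlog_phiN = dlog_th3 - th2 * (th3 + th2) * (th3 ^+ 2 + th2 ^+ 2) by rewrite
  /dlog_th3; ring.
ring.
Qed.

(** The form for [lambert 3] has degree 8, so its derivative contains 8 [dlog_th3] times itself,
    which cancels against the term with 8 [dlog_phiN]. *)
Lemma lambert5E_th : 2%:R * lambert 5 = th3 * th2 * (th3 ^+ 2 + th2 ^+ 2) *
  (th3 + th2) ^+ 4 *
  (th3 ^+ 4 + 12%:R * th3 ^+ 3 * th2 + 6%:R * th3 ^+ 2 * th2 ^+ 2 + 12%:R * th3 *
    th2 ^+ 3 + th2 ^+ 4).
Proof.
apply: oppr_inj; rewrite -mulNr lambert5E mulNr lambert3E fDN.
rewrite !(fDX, fDM, fDD, fD_nat, fD_th3, fD_th2) /= !expr1.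
have -> : dlog_phiN = dlog_th3 - th2 * (th3 + th2) * (th3 ^+ 2 + th2 ^+ 2) by rewrite
  /dlog_th3; ring.
ring.
Qed.

(** * The Eisenstein series of weight 6 *)

Definition E6 : fps := locked (1 - 504%:R * sigma 5).

Lemma E6E : E6 = 1 - 504%:R * sigma 5. Proof. by rewrite /E6 -lock. Qed.

Lemma E6_0 : E6@_0 = 1.
Proof. by rewrite E6E fcoefB fcoef_natM mulr0 subr0. Qed.

Lemma E6_sub_del : 2%:R * (E6 - del E6) = - 504%:R * (2%:R * lambert 5).
Proof.
have -> : lambert 5 = sigma 5 - del (sigma 5).
  by rewrite -[X in X - _]sigma_odd_part addrK.
by rewrite E6E !delE; ring.
Qed.

(** At a = th3^2, b = th2^2 this is 2 E_6(q^2), by [E6_del]. Being a polynomial in squares, it can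
    be rewritten by the doubling formulas. *)
Definition e6 (a b : fps) := 2%:R * (a ^+ 2 + 6%:R * a * b + b ^+ 2) *
  ((a ^+ 2 + 6%:R * a * b + b ^+ 2) ^+ 2 - 144%:R * a * b * (a + b) ^+ 2).

Lemma del_e6 f g : del (e6 f g) = e6 (del f) (del g).
Proof. by rewrite /e6 !delE. Qed.

Lemma E6_del : 2%:R * del E6 = e6 (th3 ^+ 2) (th2 ^+ 2).
Proof.
(* Both sides have constant term 2, and the remaining claim f = f(q^2) is the image of [E6_sub_del]
   under q -> q^2. *)
apply/eqP; rewrite -subr_eq0; apply/eqP; apply: (dil_uniq 1).
  rewrite fcoefB fcoef_natM fcoef_dil0 E6_0 /e6.
  by rewrite !(fcoefM0, fcoefD, fcoefN, fcoef_exp0, fcoefMn, fcoef1) th3_0 th2_0 /=; ring.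
rewrite mul1r; apply/eqP; rewrite -subr_eq0; apply/eqP.
transitivity (del (2%:R * (E6 - del E6)) - e6 (th3 ^+ 2) (th2 ^+ 2)
   + e6 (del th3 ^+ 2) (del th2 ^+ 2)).
  by rewrite dilB del_e6 !delE; ring.
rewrite E6_sub_del lambert5E_th !delE /e6 th3_sq th2_sq.
by ring.
Qed.

Lemma E6_th : 2%:R * E6 = e6 (th3 ^+ 2) (th2 ^+ 2) - 504%:R * (2%:R * lambert 5).
Proof.
rewrite -E6_del; have -> : 2%:R * E6 = 2%:R * del E6 + 2%:R * (E6 - del E6) by ring.
by rewrite E6_sub_del; ring.
Qed.

Lemma dil_del d f : dil (d.*2) f = del (dil d f).
Proof. by rewrite dil_dil // mul2n. Qed.

(** Here and for 8 and 16, the previous formula is taken at q^2, and the resulting polynomial in x,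
    y is recognized as one in x^2 + y^2 = th3^2 and 2 x y = th2^2. *)
Lemma E6_dil4 : 2%:R * dil 4 E6 =
  2%:R * (th3 ^+ 4 + th2 ^+ 4) * ((th3 ^+ 4 + th2 ^+ 4) ^+ 2 - 36%:R * th3 ^+ 4 *
    th2 ^+ 4).
Proof.
rewrite (dil_del 2) -{1}del_nat -delM E6_del del_e6 !delE /e6.
transitivity (2%:R * (th3 ^+ 2 ^+ 2 + th2 ^+ 2 ^+ 2) *
  ((th3 ^+ 2 ^+ 2 + th2 ^+ 2 ^+ 2) ^+ 2 - 36%:R * th3 ^+ 2 ^+ 2 * th2 ^+ 2 ^+ 2));
    last by ring.
by rewrite th3_sq th2_sq; ring.
Qed.

Lemma E6_dil8 : 8%:R * dil 8 E6 =
  (2%:R * th3 ^+ 4 - th2 ^+ 4) * ((2%:R * th3 ^+ 4 - th2 ^+ 4) ^+ 2 - 9%:R * th2 ^+ 8).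
Proof.
rewrite (dil_del 4); transitivity (4%:R * del (2%:R * dil 4 E6)).
  by rewrite !delE; ring.
rewrite E6_dil4 !delE.
transitivity ((2%:R * th3 ^+ 2 ^+ 2 - th2 ^+ 2 ^+ 2) *
  ((2%:R * th3 ^+ 2 ^+ 2 - th2 ^+ 2 ^+ 2) ^+ 2 - 9%:R * th2 ^+ 2 ^+ 4)); last by ring.
by rewrite th3_sq th2_sq; ring.
Qed.

Lemma E6_dil16 : 64%:R * dil 16 E6 =
  (2%:R * th3 ^+ 4 - th2 ^+ 4) * (8%:R * (2%:R * th3 ^+ 4 - th2 ^+ 4) ^+ 2 - 9%:R *
    th2 ^+ 8).
Proof.
rewrite (dil_del 8); transitivity (8%:R * del (8%:R * dil 8 E6)).
  by rewrite !delE; ring.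
rewrite E6_dil8 !delE.
transitivity ((2%:R * th3 ^+ 2 ^+ 2 - th2 ^+ 2 ^+ 2) *
  (8%:R * (2%:R * th3 ^+ 2 ^+ 2 - th2 ^+ 2 ^+ 2) ^+ 2 - 9%:R * th2 ^+ 2 ^+ 4));
    last by ring.
by rewrite th3_sq th2_sq; ring.
Qed.

(** * The Euler function *)

(** The product of all 1 - q^m, that is eta without its factor q^(1/24). *)
Definition euler : fps := locked (Fps (qcoefs eta)).

Lemma eulerE : euler = Fps (qcoefs eta). Proof. by rewrite /euler -lock. Qed.

Definition fpoly (p : {poly rat}) := Fps (fun n => p`_n).

Lemma fpolyM p q : fpoly (p * q) = fpoly p * fpoly q.
Proof. by apply/fpsP => n; rewrite /= coefM. Qed.

Lemma fpoly1 : fpoly 1 = 1.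
Proof. by apply/fpsP => n; rewrite /= coef1. Qed.

Lemma fpoly_factor m : fpoly (1 - 'X^m) = 1 - fX ^+ m.
Proof. by apply/fpsP => n; rewrite fcoefB fcoef1 fcoefXn /= coefB coef1 coefXn. Qed.

Definition euler_prod N : fps := \prod_(1 <= m < N.+1) (1 - fX ^+ m).

Lemma euler_prodE N : fpoly (\prod_(1 <= m < N.+1) (1 - 'X^m)) = euler_prod N.
Proof.
rewrite (big_morph fpoly fpolyM fpoly1); apply: eq_bigr => m _.
exact: fpoly_factor.
Qed.

Lemma euler_prodS N : euler_prod N.+1 = euler_prod N * (1 - fX ^+ N.+1).
Proof. by rewrite /euler_prod big_nat_recr. Qed.

Lemma euler_prod_coef N n : (n <= N)%N -> (euler_prod N)@_n = euler@_n.
Proof.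
move=> nN; rewrite -(subnKC nN); elim: (N - n)%N => [|d IH].
  by rewrite addn0 -euler_prodE eulerE.
by rewrite addnS euler_prodS mulrBr mulr1 mulrC fcoefB fcoefMXn ltnS leq_addr subr0.
Qed.

Lemma euler0 : euler@_0 = 1.
Proof. by rewrite -(euler_prod_coef 0) // /euler_prod big_geq // fcoef1. Qed.

(* m q^m / (1 - q^m) *)
Definition lambert_term m :=
  Fps (fun n => if (0 < n)%N && (m %| n)%N then m%:R else 0).

Lemma lambert_termE m : (0 < m)%N ->
  lambert_term m * (1 - fX ^+ m) = m%:R * fX ^+ m.
Proof.
move=> m0; apply/fpsP => n;
  rewrite mulrBr mulr1 [lambert_term m * _]mulrC fcoefB fcoefMXn.
rewrite fcoef_natM fcoefXn /=; case: (ltngtP n m) => nm.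
- rewrite subr0 mulr0; case: ifP => // /andP[n0 /dvdn_leq].
  by move/(_ n0); rewrite leqNgt nm.
- rewrite (dvdn_subl _ (dvdnn m)) ?subn_gt0 ?nm ?mulr0; last exact: ltnW.
  by rewrite (leq_trans _ nm) // subrr.
by rewrite nm m0 dvdnn subnn /= subr0 mulr1.
Qed.

(** Each factor 1 - q^m contributes - m q^m / (1 - q^m) to the logarithmic derivative; adding these
    up collects the divisors m of every exponent. *)
Lemma fD_euler : fD euler = - sigma 1 * euler.
Proof.
have D N : fD (euler_prod N) =
    - (\sum_(1 <= m < N.+1) lambert_term m) * euler_prod N.
  elim: N => [|N IH].
    by rewrite /euler_prod !big_geq // fD1 oppr0 mul0r.
  rewrite euler_prodS fDM IH fDB fD1 [in RHS]big_nat_recr //=.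
  have -> : fD (fX ^+ N.+1) = lambert_term N.+1 * (1 - fX ^+ N.+1).
    rewrite lambert_termE //; apply/fpsP => n.
    by rewrite fcoef_natM fD_coef !fcoefXn; case: eqP => [->|]; rewrite ?mulr0.
  by ring.
apply/fpsP => n; rewrite fD_coef -(euler_prod_coef n) // -fD_coef D.
(* Up to degree n the partial sum and the partial product already have the coefficients of their
   limits. *)
apply: (fcoefM_le _ _ _ _ n) => // i lein; last exact: euler_prod_coef.
rewrite !fcoefN fcoef_sum; congr (- _).
case: i lein => [|i] lein; first by rewrite big1.
rewrite /= natr_sum.
transitivity (\sum_(m <- index_iota 1 n.+1 | (m %| i.+1)%N) (m ^ 1)%:R : rat).
  rewrite [RHS]big_mkcond; apply: eq_bigr => m _.
  by rewrite expn1.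
rewrite -[LHS]big_filter; apply: perm_big; apply: uniq_perm.
- by rewrite filter_uniq // iota_uniq.
- exact: divisors_uniq.
move=> m; rewrite mem_filter mem_index_iota -dvdn_divisors //.
case: (boolP (m %| i.+1)%N) => //= mi.
by rewrite (dvdn_gt0 _ mi) //= ltnS (leq_trans (dvdn_leq _ mi)).
Qed.

(** Both sides have constant term 1 and, by [sigma_odd_part], logarithmic derivative - 2
    [sigma 1]. *)
Lemma phiN_euler : phiN * del euler = euler ^+ 2.
Proof.
apply: (ode_uniq (- 2%:R * sigma 1)).
- by rewrite fcoefM0 mulr0.
- rewrite fDM fD_phiN fD_del fD_euler !delE.
  by rewrite -{2}[sigma 1]sigma_odd_part; ring.
- by rewrite fDX fD_euler /= expr1; ring.
by rewrite fcoef_exp0 fcoefM0 fcoef_dil0 euler0 phiNE fcoefB th3_0 th2_0; ring.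
Qed.

Notation eul d := (dil d euler).

Lemma eul0 d : (eul d)@_0 = 1. Proof. by rewrite fcoef_dil0 euler0. Qed.

Lemma eul_neq0 d : eul d != 0.
Proof. by apply: (fps_neq0 _ 0); rewrite eul0. Qed.

Lemma dil_phiN_eul d : (0 < d)%N -> dil d phiN * eul (d * 2) = eul d ^+ 2.
Proof.
by move=> d0; rewrite -dil_dil // -dilM // -dilX // -phiN_euler.
Qed.

(** * Theta constants as eta quotients *)

Lemma th3_dil : th3 * dil 4 phiN = dil 8 phiN ^+ 2.
Proof.
have := congr1 (dil 4) phi_phiN.
by rewrite dilM // dil_dil // dilX // th3E.
Qed.

(** The product theta_3(q) = eta(2z)^5 / (eta(z)^2 eta(4z)^2), taken at q^4 and without
    denominators. *)
Lemma th3_eul : th3 * eul 4 ^+ 2 * eul 16 ^+ 2 = eul 8 ^+ 5.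
Proof.
rewrite -(dil_phiN_eul 4) //=.
transitivity ((th3 * dil 4 phiN) * eul 16 ^+ 2 * eul 8); first by ring.
rewrite th3_dil; transitivity ((dil 8 phiN * eul 16) ^+ 2 * eul 8); first by ring.
by rewrite (dil_phiN_eul 8) //; ring.
Qed.

(** Both sides A, B satisfy f^2 [eul 16] = 2 th3(q^2) [eul 8 ^+ 2] f(q^2). Subtracting and factoring
    A^2 - B^2 gives a linear equation for A - B, to which [dil_uniq2] applies. *)
Lemma th2_eul : th2 * eul 8 = 2%:R * fX * eul 16 ^+ 2.
Proof.
apply/eqP; rewrite -subr_eq0; apply/eqP; set A := th2 * _; set B := _ * eul 16 ^+ 2.
have A0 : A@_0 = 0 by rewrite fcoefM0 th2_0 mul0r.
have A1 : A@_1 = 2 by rewrite fcoefM1 th2_0 th2_1 eul0 mul0r add0r mulr1.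
have B0 : B@_0 = 0 by rewrite /B -mulrA fcoef_natM fcoefMX mulr0.
have B1 : B@_1 = 2 by rewrite /B -mulrA fcoef_natM fcoefMX fcoef_exp0 eul0 expr1n mulr1.
have [e4 e8 e16] : [/\ del (eul 4) = eul 8, del (eul 8) = eul 16 & del (eul 16) = eul 32].
  by rewrite !dil_dil.
have eq_A : A ^+ 2 * eul 16 = 2%:R * del th3 * eul 8 ^+ 2 * del A.
  by rewrite /A exprMn th2_sq delM e8; ring.
have eq_B : B ^+ 2 * eul 16 = 2%:R * del th3 * eul 8 ^+ 2 * del B.
  have e : del th3 * eul 8 ^+ 2 * eul 32 ^+ 2 = eul 16 ^+ 5.
    by have := congr1 del th3_eul; rewrite !delE e4 e8 e16.
  have -> : del B = 2%:R * fX ^+ 2 * eul 32 ^+ 2 by rewrite /B !delE dil_fX // e16.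
  transitivity (4%:R * fX ^+ 2 * eul 16 ^+ 5); first by rewrite /B; ring.
  by rewrite -e; ring.
apply: (dil_uniq2 ((A + B) * eul 16) (2%:R * del th3 * eul 8 ^+ 2)).
- by rewrite fcoefM0 fcoefD A0 B0 mul0r.
- by rewrite fcoefM1 !fcoefD A0 A1 B0 B1 eul0.
- by rewrite fcoefB A0 B0.
- by rewrite fcoefB A1 B1.
transitivity (A ^+ 2 * eul 16 - B ^+ 2 * eul 16); first by ring.
by rewrite eq_A eq_B dilB; ring.
Qed.

Lemma eul8_4 : 2%:R * fX * eul 8 ^+ 4 = th3 * th2 * eul 4 ^+ 2.
Proof.
apply: (@fmulI (eul 8)); first exact: eul_neq0.
transitivity (2%:R * fX * eul 8 ^+ 5); first by ring.
rewrite -th3_eul; transitivity (th3 * eul 4 ^+ 2 * (2%:R * fX * eul 16 ^+ 2));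
  first by ring.
by rewrite -th2_eul; ring.
Qed.

Lemma eul2_4 : eul 2 ^+ 4 = (th3 ^+ 2 - th2 ^+ 2) * eul 4 ^+ 2.
Proof.
rewrite -phiN_del_sq -dilB -phiNE.
transitivity ((eul 2 ^+ 2) ^+ 2); first by ring.
by rewrite -(dil_phiN_eul 2) //=; ring.
Qed.

Lemma eul4_8 : eul 4 ^+ 8 = (th3 ^+ 4 - th2 ^+ 4) * eul 8 ^+ 4.
Proof.
transitivity ((eul 4 ^+ 2) ^+ 4); first by ring.
rewrite -(dil_phiN_eul 4) // exprMn; congr (_ * _).
rewrite (dil_del 2); transitivity (del (del phiN ^+ 2) ^+ 2); first by rewrite !delE;
  ring.
rewrite phiNE [del (_ - _)]dilB phiN_del_sq !delE.
transitivity (th3 ^+ 2 ^+ 2 - th2 ^+ 2 ^+ 2); last by ring.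
by rewrite th3_sq th2_sq; ring.
Qed.

(** Expresses eta(4z)^6 by theta constants; every B_{32,i} contains this factor once the other eta
    factors are replaced. *)
Lemma eul4_6 : 2%:R * fX * eul 4 ^+ 6 = th3 * th2 * (th3 ^+ 4 - th2 ^+ 4).
Proof.
apply: (@fmulI (eul 4 ^+ 2)).
  by apply: (fps_neq0 _ 0); rewrite fcoef_exp0 eul0 expr1n.
transitivity (2%:R * fX * eul 4 ^+ 8); first by ring.
rewrite eul4_8; transitivity ((th3 ^+ 4 - th2 ^+ 4) * (2%:R * fX * eul 8 ^+ 4));
  first by ring.
by rewrite eul8_4; ring.
Qed.

(** * Eta quotients *)

Lemma fps_expE f k : Fps (fps_exp (fcoef f) k) = f ^+ k.
Proof.
by elim: k => [|k IH] //; rewrite exprS -IH.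
Qed.

Lemma fcoef_exp_lt f k n : f@_0 = 0 -> (n < k)%N -> (f ^+ k)@_n = 0.
Proof.
move=> f0; elim: k n => // k IH n; rewrite ltnS => nk.
rewrite exprS fcoefM big1 // => i _; case: (posnP i) => [->|i0].
  by rewrite f0 mul0r.
by rewrite IH ?mulr0 //; have := ltn_ord i; lia.
Qed.

(** Geometric series in g = 1 - f: up to degree n it may be cut after g^n, and the telescoping error
    g^(n+1) has no term of degree at most n. *)
Lemma fps_invE f : f@_0 = 1 -> Fps (fps_inv (fcoef f)) * f = 1.
Proof.
move=> f0; pose g := 1 - f.
have g0 : g@_0 = 0 by rewrite fcoefB fcoef1 f0 subrr.
have inv_le N n : (n <= N)%N ->
    (Fps (fps_inv (fcoef f)))@_n = (\sum_(k < N.+1) g ^+ k)@_n.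
  move=> nN; rewrite /= /fps_inv f0 invr1 mul1r fcoef_sum.
  rewrite (big_ord_widen_cond N.+1 xpredT (fun k => fps_exp _ k n)) //.
  rewrite big_mkcond; apply: eq_bigr => k _; rewrite ltnS.
  case: leqP => nk; last by rewrite fcoef_exp_lt.
  have -> : (fun j => fps_one j - fcoef f j / 1) = fcoef g.
    by apply/funext => j; rewrite divr1.
  by rewrite -fps_expE.
apply/fpsP => n.
rewrite (fcoefM_le _ (\sum_(k < n.+1) g ^+ k) f f n) //; last by move=> i; exact: inv_le.
have -> : (\sum_(k < n.+1) g ^+ k) * f = 1 - g ^+ n.+1.
  rewrite -[1 - _]opprB subrX1 -mulNr opprB mulrC; congr (_ * _).
  by rewrite /g; ring.
by rewrite fcoefB fcoef_exp_lt // subr0.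
Qed.

Notation cof A := (Fps (qcoefs A)).

Lemma cof_pow d k : cof (qpow (qdilate d eta) (Posz k)) = eul d ^+ k.
Proof.
by rewrite eulerE; elim: k => // k IH; rewrite exprS -IH.
Qed.

Lemma cof_pow_neg d k :
  cof (qpow (qdilate d eta) (Negz k)) * eul d ^+ k.+1 = 1.
Proof.
have -> : cof (qpow (qdilate d eta) (Negz k)) =
    Fps (fps_inv (fcoef (eul d))) ^+ k.+1.
  by rewrite eulerE /qpow; elim: k.+1 => // m IH; rewrite exprS -IH.
by rewrite -exprMn fps_invE ?eul0 // expr1n.
Qed.

Lemma qexpo_pow d k : qexpo (qpow (qdilate d eta) k) = k%:~R * (d%:R / 24%:R).
Proof.
have it A m : qexpo (iter m (qmul A) qone) = m%:R * qexpo A.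
  by elim: m => [|m IH]; rewrite ?mul0r //= IH -[m.+1]addn1 natrD; ring.
case: k => k; rewrite /qpow it /=; first by rewrite mul1r.
by rewrite NegzE rmorphN /= mul1r mulrN mulNr.
Qed.

Lemma qcoef_shift A e n : qexpo A = e%:R -> qcoef A n%:R = (fX ^+ e * cof A)@_n.
Proof.
move=> eA; rewrite /qcoef eA fcoefMXn; case: ltnP => en.
  rewrite ifF //; apply/negP => /natrP [m /(canRL (subrK _))].
  by rewrite -natrD => /eqP; rewrite eqr_nat => /eqP; lia.
by rewrite -natrB // natr_nat natrK.
Qed.

Lemma ext0E (F : nat -> rat) n d : (0 < n)%N -> (0 < d)%N ->
  ext0 F (n%:R / d%:R) = if (d %| n)%N then F (n %/ d)%N else 0.
Proof.
move=> n0 d0; rewrite /ext0; have d0' : d%:R != 0 :> rat by rewrite pnatr_eq0 -lt0n.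
case: ifPn => [/andP[/natrP[m e] _]|].
  have -> : n = (m * d)%N.
    by apply/eqP; rewrite -(eqr_nat rat) natrM -e divfK.
  by rewrite natrM mulfK // natrK dvdn_mull // mulnK.
rewrite divr_gt0 ?ltr0n // andbT; case: ifP => // dn.
by rewrite -[n](divnK dn) natrM mulfK // natr_nat.
Qed.

Lemma sigma5E n d : (0 < n)%N -> (0 < d)%N ->
  sigma5 (n%:R / d%:R) = (dil d (sigma 5))@_n.
Proof.
move=> n0 d0; rewrite /sigma5 ext0E //=; case: ifP => // dn.
by have : (0 < n %/ d)%N by [rewrite divn_gt0 // dvdn_leq]; case: (n %/ d)%N.
Qed.

(** The eta exponents of B_{32,i} add up to i exactly, see [B32_expo], so the series is integral and
    starts at q^i. *)
Definition Bs i := fX ^+ i * cof (B32 i).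

Lemma b32E i n d : qexpo (B32 i) = i%:R -> (0 < n)%N -> (0 < d)%N ->
  b32 i (n%:R / d%:R) = (dil d (Bs i))@_n.
Proof.
move=> ei n0 d0; rewrite /b32 ext0E //=; case: ifP => // dn.
by rewrite (qcoef_shift _ i).
Qed.

Lemma qexpo_quotient s :
  qexpo (eta_quotient s) = \sum_(p <- s) p.2%:~R * (p.1%:R / 24%:R).
Proof.
elim: s => [|p s IH]; first by rewrite big_nil.
by rewrite big_cons -IH -qexpo_pow.
Qed.

Lemma B32_expo i : (0 < i < 8)%N -> qexpo (B32 i) = i%:R.
Proof.
case/andP; do 8?[case: i => [//|i]] => // _ _;
  by rewrite /B32 qexpo_quotient !big_cons big_nil /=; field.
Qed.

Lemma dil_1 f : dil 1 f = f.
Proof. by apply/fpsP => n; rewrite /= dvd1n divn1. Qed.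

Notation epow d k := (cof (qpow (qdilate d eta) k)).

Lemma B1E : Bs 1 = fX ^+ 1 * (eul 2 ^+ 12).
Proof.
congr (_ * _); transitivity (epow 2 12 * 1); first by [].
by rewrite mulr1; exact: cof_pow.
Qed.

Lemma B2E : Bs 2 = fX ^+ 2 * (eul 4 ^+ 12).
Proof.
congr (_ * _); transitivity (epow 4 12 * 1); first by [].
by rewrite mulr1; exact: cof_pow.
Qed.

Lemma B3E : Bs 3 = fX ^+ 3 * (eul 2 ^+ 4 * eul 8 ^+ 8).
Proof.
congr (_ * _); transitivity (epow 2 4 * (epow 8 8 * 1)); first by [].
by rewrite mulr1; congr (_ * _); exact: cof_pow.
Qed.

Lemma B4E : Bs 4 = fX ^+ 4 * (eul 8 ^+ 12).
Proof.
congr (_ * _); transitivity (epow 8 12 * 1); first by [].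
by rewrite mulr1; exact: cof_pow.
Qed.

Lemma B5E : Bs 5 = fX ^+ 5 * (eul 4 ^+ 2 * (eul 8 ^+ 6 * eul 16 ^+ 4)).
Proof.
congr (_ * _); transitivity (epow 4 2 * (epow 8 6 * (epow 16 4 * 1))); first by [].
by rewrite mulr1; congr (_ * (_ * _)); exact: cof_pow.
Qed.

Lemma B6E : Bs 6 = fX ^+ 6 * (eul 4 ^+ 4 * eul 16 ^+ 8).
Proof.
congr (_ * _); transitivity (epow 4 4 * (epow 16 8 * 1)); first by [].
by rewrite mulr1; congr (_ * _); exact: cof_pow.
Qed.

Lemma B7E : exists f, f * eul 8 ^+ 6 = 1 /\
  Bs 7 = fX ^+ 7 * (eul 4 ^+ 6 * (f * eul 16 ^+ 12)).
Proof.
(* [Negz 5] is the exponent - 6. *)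
exists (epow 8 (Negz 5)); split; first exact: cof_pow_neg.
congr (_ * _).
transitivity (epow 4 6 * (epow 8 (Negz 5) * (epow 16 12 * 1))); first by [].
apply: (congr2 *%R (cof_pow 4 6)); apply: (congr2 *%R erefl).
exact: etrans (mulr1 _) (cof_pow 16 12).
Qed.

(* theta_4(q^4)^4, by Jacobi's identity *)
Definition th4p4 := th3 ^+ 4 - th2 ^+ 4.

(** Here and for the other i, one factor 2 goes with each q, whence 2^i. The blocks [eul 2 ^+ 4], 2
    q [eul 8 ^+ 4] and 2 q [eul 16 ^+ 2] are replaced by theta constants, and the remaining powers
    of [eul 4] form 2 q [eul 4 ^+ 6] or its square. *)
Lemma Bs1 : 2%:R * Bs 1 = (th3 ^+ 2 - th2 ^+ 2) ^+ 3 * (th3 * th2 * th4p4).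
Proof.
have -> : Bs 1 = fX * (eul 2 ^+ 4) ^+ 3.
  by rewrite B1E; ring.
by rewrite eul2_4 -eul4_6; ring.
Qed.

Lemma Bs2 : 4%:R * Bs 2 = (th3 * th2 * th4p4) ^+ 2.
Proof.
by rewrite -eul4_6 B2E; ring.
Qed.

Lemma Bs3 : 8%:R * Bs 3 = (th3 ^+ 2 - th2 ^+ 2) * (th3 * th2) ^+ 2 * (th3 * th2 * th4p4).
Proof.
transitivity (eul 2 ^+ 4 * (2%:R * fX * eul 8 ^+ 4) ^+ 2 * (2%:R * fX)).
  by rewrite B3E; ring.
by rewrite eul2_4 eul8_4 -eul4_6; ring.
Qed.

Lemma Bs4 : 16%:R * Bs 4 = (th3 * th2) ^+ 3 * (th3 * th2 * th4p4).
Proof.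
transitivity ((2%:R * fX * eul 8 ^+ 4) ^+ 3 * (2%:R * fX)).
  by rewrite B4E; ring.
by rewrite eul8_4 -eul4_6; ring.
Qed.

Lemma Bs5 : 32%:R * Bs 5 = (th3 * th2) ^+ 2 * th2 ^+ 2 * (th3 * th2 * th4p4).
Proof.
transitivity (eul 4 ^+ 2 * eul 8 ^+ 6 * (2%:R * fX * eul 16 ^+ 2) ^+ 2 * (2%:R *
  fX) ^+ 3).
  by rewrite B5E; ring.
rewrite -th2_eul.
transitivity (eul 4 ^+ 2 * th2 ^+ 2 * (2%:R * fX * eul 8 ^+ 4) ^+ 2 * (2%:R * fX));
  first by ring.
by rewrite eul8_4 -eul4_6; ring.
Qed.

Lemma Bs6 : 64%:R * Bs 6 = th3 * th2 * th2 ^+ 4 * (th3 * th2 * th4p4).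
Proof.
transitivity (eul 4 ^+ 4 * (2%:R * fX * eul 16 ^+ 2) ^+ 4 * (2%:R * fX) ^+ 2).
  by rewrite B6E; ring.
rewrite -th2_eul.
transitivity (eul 4 ^+ 4 * th2 ^+ 4 * (2%:R * fX * eul 8 ^+ 4) * (2%:R * fX));
  first by ring.
by rewrite eul8_4 -eul4_6; ring.
Qed.

Lemma Bs7 : 128%:R * Bs 7 = th2 ^+ 6 * (th3 * th2 * th4p4).
Proof.
have [f [fE ->]] := B7E.
transitivity (eul 4 ^+ 6 * f * (2%:R * fX * eul 16 ^+ 2) ^+ 6 * (2%:R * fX));
  first by ring.
rewrite -th2_eul.
transitivity (f * eul 8 ^+ 6 * th2 ^+ 6 * (2%:R * fX * eul 4 ^+ 6)); first by ring.
by rewrite fE eul4_6 /th4p4; ring.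
Qed.

(** The substitution q -> q^2 sends B_{32,1} to B_{32,2}, B_{32,2} to B_{32,4} and B_{32,3} to
    B_{32,6}; this removes the arguments n/2 and n/4 of the b_{32,i}. *)
Lemma del_Bs1 : del (Bs 1) = Bs 2.
Proof.
have e : del (fX ^+ 1 * (eul 2 ^+ 12)) = fX ^+ 2 * (eul 4 ^+ 12).
  rewrite delM !delX (dil_fX 2 isT).
  by have -> : del (eul 2) = eul 4 by [rewrite dil_dil]; ring.
exact: (etrans (congr1 del B1E) (etrans e (esym B2E))).
Qed.

Lemma del_Bs2 : del (Bs 2) = Bs 4.
Proof.
have e : del (fX ^+ 2 * (eul 4 ^+ 12)) = fX ^+ 4 * (eul 8 ^+ 12).
  rewrite delM !delX (dil_fX 2 isT).
  by have -> : del (eul 4) = eul 8 by [rewrite dil_dil]; ring.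
exact: (etrans (congr1 del B2E) (etrans e (esym B4E))).
Qed.

Lemma del_Bs3 : del (Bs 3) = Bs 6.
Proof.
have e : del (fX ^+ 3 * (eul 2 ^+ 4 * eul 8 ^+ 8)) = fX ^+ 6 * (eul 4 ^+ 4 * eul 16 ^+ 8).
  rewrite delM (delM (eul 2 ^+ 4)) !delX (dil_fX 2 isT).
  have -> : del (eul 2) = eul 4 by rewrite dil_dil.
  by have -> : del (eul 8) = eul 16 by [rewrite dil_dil]; ring.
exact: (etrans (congr1 del B3E) (etrans e (esym B6E))).
Qed.

Lemma b32_half i j n : (0 < i < 8)%N -> (0 < j < 8)%N -> del (Bs i) = Bs j ->
  (0 < n)%N -> b32 i (n%:R / 2%:R) = b32 j n%:R.
Proof.
move=> ilt jlt e n0; rewrite (b32E _ _ _ (B32_expo _ ilt)) // e.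
by rewrite -[n%:R]divr1 (b32E _ _ 1%N (B32_expo _ jlt)) // dil_1.
Qed.

Lemma b32_1_2 n : (0 < n)%N -> b32 1 (n%:R / 2%:R) = b32 2 n%:R.
Proof. by move=> n0; apply: b32_half => //; exact: del_Bs1. Qed.

Lemma b32_2_2 n : (0 < n)%N -> b32 2 (n%:R / 2%:R) = b32 4 n%:R.
Proof. by move=> n0; apply: b32_half => //; exact: del_Bs2. Qed.

Lemma b32_3_2 n : (0 < n)%N -> b32 3 (n%:R / 2%:R) = b32 6 n%:R.
Proof. by move=> n0; apply: b32_half => //; exact: del_Bs3. Qed.

Lemma b32_1_4 n : (0 < n)%N -> b32 1 (n%:R / 4%:R) = b32 4 n%:R.
Proof.
move=> n0; apply: etrans (b32E 1 n 4 (B32_expo 1 isT) n0 isT) _.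
apply: etrans _ (b32_2_2 n n0).
apply: etrans _ (esym (b32E 2 n 2 (B32_expo 2 isT) n0 isT)).
have e : dil 4 (Bs 1) = del (Bs 2) := etrans (dil_del 2 (Bs 1)) (congr1 del del_Bs1).
exact (congr1 (fun f => f@_n) e).
Qed.

(** The forms 2^i B_{32,i}; the default branch stands for i = 7. *)
Definition cusp i := match i with
  | 1 => (th3 ^+ 2 - th2 ^+ 2) ^+ 3 * (th3 * th2 * th4p4)
  | 2 => (th3 * th2 * th4p4) ^+ 2
  | 3 => (th3 ^+ 2 - th2 ^+ 2) * (th3 * th2) ^+ 2 * (th3 * th2 * th4p4)
  | 4 => (th3 * th2) ^+ 3 * (th3 * th2 * th4p4)
  | 5 => (th3 * th2) ^+ 2 * th2 ^+ 2 * (th3 * th2 * th4p4)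
  | 6 => th3 * th2 * th2 ^+ 4 * (th3 * th2 * th4p4)
  | _ => th2 ^+ 6 * (th3 * th2 * th4p4)
  end.

Lemma b32_cusp i n : (0 < i < 8)%N -> (0 < n)%N ->
  (2 ^ i)%:R * b32 i n%:R = (cusp i)@_n.
Proof.
move=> ilt n0; rewrite -[n%:R]divr1 (b32E _ _ 1%N (B32_expo _ ilt)) // dil_1.
rewrite -fcoef_natM; suff -> : (2 ^ i)%:R * Bs i = cusp i by [].
case: i ilt => [|[|[|[|[|[|[|[|i]]]]]]]] // _.
- exact: Bs1.
- exact: Bs2.
- exact: Bs3.
- exact: Bs4.
- exact: Bs5.
- exact: Bs6.
exact: Bs7.
Qed.

(** * Representation numbers *)

(** Natural-number version of [sumsq], since exponents in [gf] are natural numbers. *)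
Definition sumsqn k (x : 'rV[int]_k) : nat := (\sum_i absz (x ord0 i) ^ 2)%N.

Arguments sumsqn {k}.

Lemma sumsqnE k (x : 'rV[int]_k) : sumsq x = (sumsqn x)%:Z.
Proof.
rewrite /sumsq /sumsqn; rewrite (big_morph Posz PoszD (erefl 0%:Z)).
apply: eq_bigr => i _; move: (x ord0 i) => y; nia.
Qed.

Lemma gf_phiX k : gf (@sumsqn k) (fun=> 1) (phi ^+ k).
Proof.
elim: k => [|k IH].
  move=> n; exists [:: 0]; split=> // [x _|]; first by rewrite thinmx0 mem_seq1.
  by rewrite big_mkcond big_seq1 /sumsqn big_ord0 fcoef1 eq_sym; case: eqP.
have g1 : gf _ _ phi := gf_theta _.
rewrite exprS; have := gf_mul g1 IH.
move/(gf_reindex (fun x : 'rV[int]_(1 + k) => (x 0 0, rsubmx x))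
  (fun y => row_mx (const_mx y.1) y.2)) => h.
apply: gf_eq (h _ _) => [x|x|x|[a x] _] /=; last 2 first.
- rewrite -[RHS]hsubmxK; congr row_mx; apply/rowP => i; rewrite !mxE ord1.
  by congr (x _ _); apply/val_inj.
- by rewrite row_mxKr mxE; case: splitP => // j _; rewrite mxE.
- rewrite /sumsqn [RHS]big_ord_recl; congr (_ + _)%N.
  by apply: eq_bigr => i _; rewrite mxE rshift1.
by rewrite mulr1.
Qed.

(** The covering list makes A finite, so [fset_set] does not take its junk value. *)
Lemma card_gf (T : choiceType) (e : T -> nat) f n (A : set T) :
    gf e (fun=> 1) f -> (forall x, A x <-> e x = n) ->
  #|` fset_set A|%:R = f@_n.
Proof.
move=> gff AP; have [s [us es ->]] := gff n.
have -> : A = [set` [fset x in [seq x <- s | e x == n]]%fset]%classic.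
  apply/seteqP; split => x /=; rewrite inE /= mem_filter.
    by move=> /AP ex; rewrite ex eqxx es.
  by move=> /andP[/eqP/AP].
rewrite set_fsetK card_fseq undup_id ?filter_uniq // size_filter.
by rewrite -sum1_count natr_sum.
Qed.

Lemma repNE k l a b n : (0 < a)%N -> (0 < b)%N ->
  (repN k l a b n)%:R = (dil a phi ^+ k * dil b phi ^+ l)@_n.
Proof.
move=> a0 b0; rewrite -!dilX // /repN.
have := gf_mul (gf_dil a a0 (gf_phiX k)) (gf_dil b b0 (gf_phiX l)).
move/(gf_reindex (fun x : 'rV[int]_(k + l) => (lsubmx x, rsubmx x))
  (fun y => row_mx y.1 y.2)) => h.
apply: card_gf (gf_eq _ _ (h _ _)) _ => //.
- by move=> x /=; rewrite hsubmxK.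
- by move=> [x y] _ /=; rewrite row_mxKl row_mxKr.
move=> x /=; rewrite !sumsqnE; split; lia.
Qed.

Lemma repr12E n : (repr12 n)%:R = (phi ^+ 12)@_n.
Proof.
apply: card_gf (gf_phiX 12) _ => x /=; rewrite sumsqnE; split; lia.
Qed.

(** * Identities between forms of degree 12 *)

Lemma dil_E6 d : (0 < d)%N -> dil d E6 = 1 - 504%:R * dil d (sigma 5).
Proof. by move=> d0; rewrite E6E dilB dil1 // dilM // dil_nat. Qed.

(** [sig1] to [sig16] are multiples of the series of sigma_5(n/d), d = 1, 2, 4, 8, 16, scaled to
    make the coefficients integral. *)
Definition sig1 := 2%:R - e6 (th3 ^+ 2) (th2 ^+ 2) +
  504%:R * (th3 * th2 * (th3 ^+ 2 + th2 ^+ 2) * (th3 + th2) ^+ 4 *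
  (th3 ^+ 4 + 12%:R * th3 ^+ 3 * th2 + 6%:R * th3 ^+ 2 * th2 ^+ 2 +
   12%:R * th3 * th2 ^+ 3 + th2 ^+ 4)).

Definition sig2 := 2%:R - e6 (th3 ^+ 2) (th2 ^+ 2).

Definition sig4 := 2%:R - 2%:R * (th3 ^+ 4 + th2 ^+ 4) *
  ((th3 ^+ 4 + th2 ^+ 4) ^+ 2 - 36%:R * th3 ^+ 4 * th2 ^+ 4).

Definition sig8 := 8%:R - (2%:R * th3 ^+ 4 - th2 ^+ 4) *
  ((2%:R * th3 ^+ 4 - th2 ^+ 4) ^+ 2 - 9%:R * th2 ^+ 8).

Definition sig16 := 64%:R - (2%:R * th3 ^+ 4 - th2 ^+ 4) *
  (8%:R * (2%:R * th3 ^+ 4 - th2 ^+ 4) ^+ 2 - 9%:R * th2 ^+ 8).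

Lemma sig1E : 1008%:R * sigma 5 = sig1.
Proof.
transitivity (2%:R - 2%:R * E6); first by rewrite E6E; ring.
by rewrite E6_th lambert5E_th /sig1; ring.
Qed.

Lemma sig2E : 1008%:R * dil 2 (sigma 5) = sig2.
Proof. by rewrite /sig2 -E6_del dil_E6 //; ring. Qed.

Lemma sig4E : 1008%:R * dil 4 (sigma 5) = sig4.
Proof. by rewrite /sig4 -E6_dil4 dil_E6 //; ring. Qed.

Lemma sig8E : 4032%:R * dil 8 (sigma 5) = sig8.
Proof. by rewrite /sig8 -E6_dil8 dil_E6 //; ring. Qed.

Lemma sig16E : 64%:R * 504%:R * dil 16 (sigma 5) = sig16.
Proof. by rewrite /sig16 -E6_dil16 dil_E6 //; ring. Qed.

(** The constants cancel, 1008 + 8 * 2 - 512 * 2 = 0, leaving a polynomial identity between forms of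
    degree 12. The same happens in the four identities that follow. *)
Lemma phi_12 :
  1008%:R * phi ^+ 12 = 1008%:R + 8%:R * sig1 - 512%:R * sig4 + 1008%:R * (8%:R * cusp 1).
Proof. by rewrite /sig1 /sig4 /cusp /th4p4 /e6 phiE; ring. Qed.

Lemma dil2_phi_sq : dil 2 phi ^+ 2 = th3 ^+ 2 + th2 ^+ 2.
Proof. by rewrite phiE dilD phi_del_sq. Qed.

Lemma phi_4_8_dil2 : 1008%:R * (2%:R * (phi ^+ 4 * dil 2 phi ^+ 8)) =
  1008%:R * 2%:R + sig1 - sig2 + 16%:R * sig4 - 256%:R * sig8 +
  504%:R * (15%:R * cusp 1) + 1008%:R * (12%:R * cusp 2 + 32%:R * cusp 3).
Proof.
have -> : dil 2 phi ^+ 8 = (th3 ^+ 2 + th2 ^+ 2) ^+ 4.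
  by rewrite -dil2_phi_sq -exprM.
by rewrite /sig1 /sig2 /sig4 /sig8 /cusp /th4p4 /e6 phiE; ring.
Qed.

(** The coefficient of [cusp 2] merges b_{32,2}(n) and b_{32,1}(n/2): 4 * 14 = 72 - 16. *)
Lemma phi_8_4_dil2 : 1008%:R * (phi ^+ 8 * dil 2 phi ^+ 4) =
  1008%:R + 2%:R * sig1 - 2%:R * sig2 + 8%:R * sig4 - 128%:R * sig8 +
  1008%:R * (7%:R * cusp 1 + 14%:R * cusp 2 + 32%:R * cusp 3).
Proof.
have -> : dil 2 phi ^+ 4 = (th3 ^+ 2 + th2 ^+ 2) ^+ 2.
  by rewrite -dil2_phi_sq -exprM.
by rewrite /sig1 /sig2 /sig4 /sig8 /cusp /th4p4 /e6 phiE; ring.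
Qed.

Lemma phi_4_8_dil4 : 1008%:R * (32%:R * (phi ^+ 4 * dil 4 phi ^+ 8)) =
  1008%:R * 32%:R + sig1 + 15%:R * sig2 - 1040%:R * sig4 + 320%:R * sig8 - 512%:R *
    sig16 +
  504%:R * (255%:R * cusp 1) +
  1008%:R * (180%:R * cusp 2 + 480%:R * cusp 3 + 48%:R * cusp 4 + 128%:R * cusp 5 +
             192%:R * cusp 6 + 128%:R * cusp 7).
Proof.
rewrite -th3E /sig1 /sig2 /sig4 /sig8 /sig16 /cusp /th4p4 /e6 phiE.
by ring.
Qed.

(** Dilated terms are merged here too, everything being doubled: 4 * 49 = 2 (126 - 28), 16 * 71 = 2
    (584 + 128 - 144), 64 * 56 = 2 (2304 - 512). *)
Lemma phi_8_4_dil4 : 1008%:R * (2%:R * (phi ^+ 8 * dil 4 phi ^+ 4)) =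
  1008%:R * 2%:R + sig1 - 5%:R * sig2 + 260%:R * sig4 - 60%:R * sig8 - 32%:R * sig16 +
  504%:R * (31%:R * cusp 1) +
  1008%:R * (49%:R * cusp 2 + 128%:R * cusp 3 + 71%:R * cusp 4 + 112%:R * cusp 5 +
             56%:R * cusp 6 + 16%:R * cusp 7).
Proof.
rewrite -th3E /sig1 /sig2 /sig4 /sig8 /sig16 /cusp /th4p4 /e6 phiE.
by ring.
Qed.

(** * Comparison of coefficients *)

Lemma fcoef_nat m n : (0 < n)%N -> (m%:R : fps)@_n = 0.
Proof. by move=> n0; rewrite fcoefMn fcoef1 gtn_eqF // mul0rn. Qed.

Lemma repNC k l a b n : (0 < a)%N -> (0 < b)%N -> repN k l a b n = repN l k b a n.
Proof.
by move=> a0 b0; apply/eqP; rewrite -(eqr_nat rat) !repNE // mulrC.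
Qed.

Lemma sigma5_coef d m f n : (0 < n)%N -> (0 < d)%N ->
  m%:R * dil d (sigma 5) = f -> m%:R * sigma5 (n%:R / d%:R) = f@_n.
Proof. by move=> n0 d0 <-; rewrite sigma5E // fcoef_natM. Qed.

Section Coefficients.
Variable n : nat.
Hypothesis n_gt0 : (0 < n)%N.
Let x : rat := n%:R.

Lemma sigma5_th :
  [/\ 1008 * sigma5 x = sig1@_n, 1008 * sigma5 (x / 2) = sig2@_n,
      1008 * sigma5 (x / 4) = sig4@_n, 4032 * sigma5 (x / 8) = sig8@_n &
      64 * (504 * sigma5 (x / 16)) = sig16@_n].
Proof.
split; last by rewrite mulrA -natrM; apply: sigma5_coef; rewrite // natrM; exact: sig16E.
- by have := sigma5_coef 1 1008 _ n n_gt0 isT (etrans (congr1 _ (dil_1 _)) sig1E);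
    rewrite divr1.
- exact (sigma5_coef 2 1008 _ n n_gt0 isT sig2E).
- exact (sigma5_coef 4 1008 _ n n_gt0 isT sig4E).
exact (sigma5_coef 8 4032 _ n n_gt0 isT sig8E).
Qed.

Lemma phi_12_coef : (phi ^+ 12)@_n = 8 * sigma5 x - 512 * sigma5 (x / 4) + 16 * b32 1 x.
Proof.
have [s1 s2 s4 s8 s16] := sigma5_th.
have c1 : 2 * b32 1 x = (cusp 1)@_n := b32_cusp 1 n isT n_gt0.
have := congr1 (fun f => f@_n) phi_12; move: s1 s4 c1.
move: (cusp 1) sig1 sig4 (phi ^+ 12) => k1 t1 t4 f.
(* Generalized because [lra] compares atoms up to conversion, unfolding b32 and sigma5. *)
generalize (b32 1 x) (sigma5 (x / 4)) (sigma5 x).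
move=> y1 z4 z1.
rewrite !(fcoef_nat _ _ n_gt0, fcoef_natM, fcoefD, fcoefN); lra.
Qed.

Lemma phi_4_8_dil2_coef : (phi ^+ 4 * dil 2 phi ^+ 8)@_n =
  (1 / 2) * sigma5 x - (1 / 2) * sigma5 (x / 2)
    + 8 * sigma5 (x / 4) - 512 * sigma5 (x / 8) + (15 / 2) * b32 1 x
    + 24 * b32 2 x + 128 * b32 3 x.
Proof.
have [s1 s2 s4 s8 s16] := sigma5_th.
have c1 : 2 * b32 1 x = (cusp 1)@_n := b32_cusp 1 n isT n_gt0.
have c2 : 4 * b32 2 x = (cusp 2)@_n := b32_cusp 2 n isT n_gt0.
have c3 : 8 * b32 3 x = (cusp 3)@_n := b32_cusp 3 n isT n_gt0.
have := congr1 (fun f => f@_n) phi_4_8_dil2; move: s1 s2 s4 s8 c1 c2 c3.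
move: (cusp 1) (cusp 2) (cusp 3) sig1 sig2 sig4 sig8 => k1 k2 k3 t1 t2 t4 t8.
move: (phi ^+ 4 * dil 2 phi ^+ 8) => f.
generalize (b32 1 x) (b32 2 x) (b32 3 x)
  (sigma5 (x / 8)) (sigma5 (x / 4)) (sigma5 (x / 2)) (sigma5 x).
move=> y1 y2 y3 z8 z4 z2 z1.
rewrite !(fcoef_nat _ _ n_gt0, fcoef_natM, fcoefD, fcoefN); lra.
Qed.

Lemma phi_8_4_dil2_coef : (phi ^+ 8 * dil 2 phi ^+ 4)@_n =
  2 * sigma5 x - 2 * sigma5 (x / 2) + 8 * sigma5 (x / 4)
    - 512 * sigma5 (x / 8) + 14 * b32 1 x - 16 * b32 1 (x / 2)
    + 72 * b32 2 x + 256 * b32 3 x.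
Proof.
have [s1 s2 s4 s8 s16] := sigma5_th.
have c1 : 2 * b32 1 x = (cusp 1)@_n := b32_cusp 1 n isT n_gt0.
have c2 : 4 * b32 2 x = (cusp 2)@_n := b32_cusp 2 n isT n_gt0.
have c3 : 8 * b32 3 x = (cusp 3)@_n := b32_cusp 3 n isT n_gt0.
have d12 : b32 1 (x / 2) = b32 2 x := b32_1_2 n n_gt0.
have := congr1 (fun f => f@_n) phi_8_4_dil2; move: d12 s1 s2 s4 s8 c1 c2 c3.
move: (cusp 1) (cusp 2) (cusp 3) sig1 sig2 sig4 sig8 => k1 k2 k3 t1 t2 t4 t8.
move: (phi ^+ 8 * dil 2 phi ^+ 4) => f.
generalize (b32 1 (x / 2)) (b32 1 x) (b32 2 x) (b32 3 x)
  (sigma5 (x / 8)) (sigma5 (x / 4)) (sigma5 (x / 2)) (sigma5 x).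
move=> w12 y1 y2 y3 z8 z4 z2 z1.
rewrite !(fcoef_nat _ _ n_gt0, fcoef_natM, fcoefD, fcoefN); lra.
Qed.

Lemma phi_4_8_dil4_coef : (phi ^+ 4 * dil 4 phi ^+ 8)@_n =
  (1 / 32) * sigma5 x + (15 / 32) * sigma5 (x / 2)
    - (65 / 2) * sigma5 (x / 4) + 40 * sigma5 (x / 8)
    - 512 * sigma5 (x / 16) + (255 / 32) * b32 1 x
    - 32 * b32 1 (x / 4) + (45 / 2) * b32 2 x + 120 * b32 3 x
    + 56 * b32 4 x + 128 * b32 5 x + 384 * b32 6 x + 512 * b32 7 x.
Proof.
have [s1 s2 s4 s8 s16] := sigma5_th.
have c1 : 2 * b32 1 x = (cusp 1)@_n := b32_cusp 1 n isT n_gt0.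
have c2 : 4 * b32 2 x = (cusp 2)@_n := b32_cusp 2 n isT n_gt0.
have c3 : 8 * b32 3 x = (cusp 3)@_n := b32_cusp 3 n isT n_gt0.
have c4 : 16 * b32 4 x = (cusp 4)@_n := b32_cusp 4 n isT n_gt0.
have c5 : 32 * b32 5 x = (cusp 5)@_n := b32_cusp 5 n isT n_gt0.
have c6 : 64 * b32 6 x = (cusp 6)@_n := b32_cusp 6 n isT n_gt0.
have c7 : 128 * b32 7 x = (cusp 7)@_n := b32_cusp 7 n isT n_gt0.
have d14 : b32 1 (x / 4) = b32 4 x := b32_1_4 n n_gt0.
have := congr1 (fun f => f@_n) phi_4_8_dil4.
move: d14 s1 s2 s4 s8 s16 c1 c2 c3 c4 c5 c6 c7.
move: (cusp 1) (cusp 2) (cusp 3) (cusp 4) (cusp 5) (cusp 6) (cusp 7) =>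
  k1 k2 k3 k4 k5 k6 k7.
move: sig1 sig2 sig4 sig8 sig16 (phi ^+ 4 * dil 4 phi ^+ 8) => t1 t2 t4 t8 t16 f.
generalize (b32 1 (x / 4)) (b32 1 x) (b32 2 x) (b32 3 x) (b32 4 x) (b32 5 x)
  (b32 6 x) (b32 7 x)
  (sigma5 (x / 16)) (sigma5 (x / 8)) (sigma5 (x / 4)) (sigma5 (x / 2)) (sigma5 x).
move=> w14 y1 y2 y3 y4 y5 y6 y7 z16 z8 z4 z2 z1.
rewrite !(fcoef_nat _ _ n_gt0, fcoef_natM, fcoefD, fcoefN); lra.
Qed.

Lemma phi_8_4_dil4_coef : (phi ^+ 8 * dil 4 phi ^+ 4)@_n =
  (1 / 2) * sigma5 x - (5 / 2) * sigma5 (x / 2)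
    + 130 * sigma5 (x / 4) - 120 * sigma5 (x / 8)
    - 512 * sigma5 (x / 16) + (31 / 2) * b32 1 x
    - 28 * b32 1 (x / 2) + 128 * b32 1 (x / 4) + 126 * b32 2 x
    - 144 * b32 2 (x / 2) + 512 * b32 3 x - 512 * b32 3 (x / 2)
    + 584 * b32 4 x + 1792 * b32 5 x + 2304 * b32 6 x
    + 1024 * b32 7 x.
Proof.
have [s1 s2 s4 s8 s16] := sigma5_th.
have c1 : 2 * b32 1 x = (cusp 1)@_n := b32_cusp 1 n isT n_gt0.
have c2 : 4 * b32 2 x = (cusp 2)@_n := b32_cusp 2 n isT n_gt0.
have c3 : 8 * b32 3 x = (cusp 3)@_n := b32_cusp 3 n isT n_gt0.
have c4 : 16 * b32 4 x = (cusp 4)@_n := b32_cusp 4 n isT n_gt0.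
have c5 : 32 * b32 5 x = (cusp 5)@_n := b32_cusp 5 n isT n_gt0.
have c6 : 64 * b32 6 x = (cusp 6)@_n := b32_cusp 6 n isT n_gt0.
have c7 : 128 * b32 7 x = (cusp 7)@_n := b32_cusp 7 n isT n_gt0.
have d12 : b32 1 (x / 2) = b32 2 x := b32_1_2 n n_gt0.
have d14 : b32 1 (x / 4) = b32 4 x := b32_1_4 n n_gt0.
have d22 : b32 2 (x / 2) = b32 4 x := b32_2_2 n n_gt0.
have d32 : b32 3 (x / 2) = b32 6 x := b32_3_2 n n_gt0.
have := congr1 (fun f => f@_n) phi_8_4_dil4.
move: d12 d14 d22 d32 s1 s2 s4 s8 s16 c1 c2 c3 c4 c5 c6 c7.
move: (cusp 1) (cusp 2) (cusp 3) (cusp 4) (cusp 5) (cusp 6) (cusp 7) =>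
  k1 k2 k3 k4 k5 k6 k7.
move: sig1 sig2 sig4 sig8 sig16 (phi ^+ 8 * dil 4 phi ^+ 4) => t1 t2 t4 t8 t16 f.
generalize (b32 1 (x / 2)) (b32 1 (x / 4)) (b32 2 (x / 2)) (b32 3 (x / 2))
  (b32 1 x) (b32 2 x) (b32 3 x) (b32 4 x) (b32 5 x) (b32 6 x) (b32 7 x)
  (sigma5 (x / 16)) (sigma5 (x / 8)) (sigma5 (x / 4)) (sigma5 (x / 2)) (sigma5 x).
move=> w12 w14 w22 w32 y1 y2 y3 y4 y5 y6 y7 z16 z8 z4 z2 z1.
rewrite !(fcoef_nat _ _ n_gt0, fcoef_natM, fcoefD, fcoefN); lra.
Qed.

End Coefficients.

Theorem corollary7p1 (n : nat) (n_gt0 : (0 < n)%N) :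
  let x : rat := n%:R in
  [/\ [/\ repN 4 8 1 1 n = repN 8 4 1 1 n,
       (repN 8 4 1 1 n)%:R =
       8 * sigma5 x - 512 * sigma5 (x / 4) + 16 * b32 1 x
     & 8 * sigma5 x - 512 * sigma5 (x / 4) + 16 * b32 1 x
       = (repr12 n)%:R],
     repN 4 8 1 2 n = repN 8 4 2 1 n /\
     (repN 8 4 2 1 n)%:R =
       (1 / 2) * sigma5 x - (1 / 2) * sigma5 (x / 2)
        + 8 * sigma5 (x / 4) - 512 * sigma5 (x / 8) + (15 / 2) * b32 1 x
        + 24 * b32 2 x + 128 * b32 3 x,
     repN 8 4 1 2 n = repN 4 8 2 1 n /\
     (repN 4 8 2 1 n)%:R =
       2 * sigma5 x - 2 * sigma5 (x / 2) + 8 * sigma5 (x / 4)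
        - 512 * sigma5 (x / 8) + 14 * b32 1 x - 16 * b32 1 (x / 2)
        + 72 * b32 2 x + 256 * b32 3 x,
     repN 4 8 1 4 n = repN 8 4 4 1 n /\
     (repN 8 4 4 1 n)%:R =
       (1 / 32) * sigma5 x + (15 / 32) * sigma5 (x / 2)
        - (65 / 2) * sigma5 (x / 4) + 40 * sigma5 (x / 8)
        - 512 * sigma5 (x / 16) + (255 / 32) * b32 1 x
        - 32 * b32 1 (x / 4) + (45 / 2) * b32 2 x + 120 * b32 3 x
        + 56 * b32 4 x + 128 * b32 5 x + 384 * b32 6 x + 512 * b32 7 x
   & repN 8 4 1 4 n = repN 4 8 4 1 n /\
     (repN 4 8 4 1 n)%:R =
       (1 / 2) * sigma5 x - (5 / 2) * sigma5 (x / 2)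
        + 130 * sigma5 (x / 4) - 120 * sigma5 (x / 8)
        - 512 * sigma5 (x / 16) + (31 / 2) * b32 1 x
        - 28 * b32 1 (x / 2) + 128 * b32 1 (x / 4) + 126 * b32 2 x
        - 144 * b32 2 (x / 2) + 512 * b32 3 x - 512 * b32 3 (x / 2)
        + 584 * b32 4 x + 1792 * b32 5 x + 2304 * b32 6 x
        + 1024 * b32 7 x].
Proof.
move=> x; split.
- split; first exact: repNC.
    by rewrite repNE // dil_1 -exprD phi_12_coef.
  by rewrite repr12E phi_12_coef.
- by split; [exact: repNC | rewrite repNE // dil_1 mulrC phi_4_8_dil2_coef].
- by split; [exact: repNC | rewrite repNE // dil_1 mulrC phi_8_4_dil2_coef].
- by split; [exact: repNC | rewrite repNE // dil_1 mulrC phi_4_8_dil4_coef].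
by split; [exact: repNC | rewrite repNE // dil_1 mulrC phi_8_4_dil4_coef].
Qed.
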